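(* Let $r>0$ and let $\kappa_r$ be the unique positive real number satisfying $\sum_{j=1}^N \zeta_j \log \sum_{k\in \mathbf{I}_j}(p_{j,k}c_{j,k}^r)^{\frac{\kappa_r}{r+\kappa_r}}=0$. If the random iterated function system $\mathcal{I}$ satisfies the uniform extra strong separation condition (UESSC), then for $\mathbf{P}$-almost all $\omega\in\Omega$ the quantization dimension $D_r(\mu_\omega)$ of order $r$ of the $1$-variable random self-similar measure $\mu_\omega$ exists and $$D_r(\mu_\omega)=\kappa_r.$$
   Context: Setting. $\mathbb{N}=\{1,2,\dots\}$. Let $d,N\in\mathbb{N}$ and let $X\subset\mathbb{R}^d$ be a non-empty compact set with $|X|>0$, where $|A|$ denotes the diameter of $A\subset\mathbb{R}^d$. Put $\Lambda=\{1,\dots,N\}$. For each $i\in\Lambda$ let $\mathbf{I}_i$ be a finite index set with $\operatorname{card}(\mathbf{I}_i)>1$, and for $j\in\mathbf{I}_i$ let $S_{i,j}:X\to X$ satisfy $\|S_{i,j}(x)-S_{i,j}(y)\|=c_{i,j}\|x-y\|$ for all $x,y\in X$, with $0<c_{i,j}<1$. Let $p_{i,j}>0$ with $\sum_{j\in\mathbf{I}_i}p_{i,j}=1$ for each $i$. The random iterated function system (RIFS) is $\mathcal{I}=\{\mathcal{I}_1,\dots,\mathcal{I}_N\}$ with $\mathcal{I}_i=\{S_{i,j}:j\in\mathbf{I}_i\}$. Let $\zeta=(\zeta_1,\dots,\zeta_N)$ be a probability vector with all $\zeta_i>0$. Let $\Omega=\Lambda^{\mathbb{N}}$ and let $\mathbf{P}$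 be the Bernoulli (product) measure on $\Omega$ giving the cylinder $\{\omega:\omega_1=v_1,\dots,\omega_n=v_n\}$ mass $\prod_{i=1}^n\zeta_{v_i}$. For $\omega=(\omega_1,\omega_2,\dots)\in\Omega$, the $1$-variable random self-similar measure is the Borel probability measure on $X$ $$\mu_\omega=\lim_{n\to\infty}\sum_{i_1\in\mathbf{I}_{\omega_1},\dots,i_n\in\mathbf{I}_{\omega_n}}(p_{\omega_1,i_1}\cdots p_{\omega_n,i_n})\,\nu\circ(S_{\omega_1,i_1}\circ\cdots\circ S_{\omega_n,i_n})^{-1},$$ where $\nu$ is any Borel probability measure on $X$ and the limit is in the Monge–Kantorovich metric $L(\mu,\nu)=\sup\{\int\phi\,d\mu-\int\phi\,d\nu:\phi:X\to\mathbb{R},\ \operatorname{Lip}(\phi)\le1\}$ (the limit exists and does not depend on $\nu$). UESSC: there exists $\beta>0$ such that for each $i\in\Lambda$, $\min\{\operatorname{dist}(E_{i,j},E_{i,j'}):j\ne j'\in\mathbf{I}_i\}\ge\beta\max\{|E_{i,j}|:j\in\mathbf{I}_i\}$, where $E_{i,j}=S_{i,j}(X)$ and $\operatorname{dist}$ is the usual distance between sets. For a Borel probability measure $\mu$ on $\mathbb{R}^d$ and $n\in\mathbb{N}$, $V_{n,r}(\mu)=\inf\{\int d(x,\alpha)^r\,d\mu(x):\alpha\subset\mathbb{R}^d,\ \operatorname{card}(\alpha)\le n\}$, with $d(x,\alpha)=\inf_{a\in\alpha}\|x-a\|$. The lower and upper quantization dimensions of order $r$ are $\underline{D}_r(\mu)=\liminf_{n\to\infty}\frac{r\log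 n}{-\log V_{n,r}(\mu)}$ and $\overline{D}_r(\mu)=\limsup_{n\to\infty}\frac{r\log n}{-\log V_{n,r}(\mu)}$; if they coincide the common value is the quantization dimension $D_r(\mu)$. (Measures on $X$ are regarded as measures on $\mathbb{R}^d$.) *)

(* Defs.v *)
From HB Require Import structures.
From mathcomp Require Import all_boot all_order all_algebra.
From mathcomp Require Import all_classical all_reals all_analysis.

Set Implicit Arguments.
Unset Strict Implicit.
Unset Printing Implicit Defensive.

Import Order.TTheory GRing.Theory Num.Theory.
Import numFieldNormedType.Exports.

Local Open Scope classical_set_scope.
Local Open Scope ring_scope.

HB.instance Definition _ (N : nat) := isPointed.Build 'I_N.+1 ord0.

(* The library's norm on ['rV[R]_d] is the sup norm; it induces the same
   topology as the Euclidean norm, but different similitudes and distances. *)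
Definition enorm (R : realType) (d : nat) (x : 'rV[R]_d) : R :=
  Num.sqrt (\sum_(i < d) x ord0 i ^+ 2).

Definition diam (R : realType) (d : nat) (A : set 'rV[R]_d) : R :=
  sup [set enorm (z.1 - z.2) | z in A `*` A].

Definition set_dist (R : realType) (d : nat) (A B : set 'rV[R]_d) : R :=
  inf [set enorm (z.1 - z.2) | z in A `*` B].

(* R^d with its Borel sigma-algebra.  A Borel probability measure on a compact
   set X is represented by a probability [m] on this space with [m X = 1]. *)
Notation borelRd R d := (g_sigma_algebraType (@open 'rV[R]_d)).

(* Sequences are indexed from 0, so [w k] is the (k+1)-st letter of [w]. *)
Definition cylinder (N : nat) (v : nat -> 'I_N.+1) (n : nat) :
    set (nat -> 'I_N.+1) :=
  [set w | forall k, (k < n)%N -> w k = v k].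

Definition cylinders (N : nat) : set (set (nat -> 'I_N.+1)) :=
  [set C | exists v n, C = cylinder v n].

(* The space of sequences over an alphabet of N+1 letters. *)
Notation Omega N := (g_sigma_algebraType (@cylinders N)).

Definition is_bernoulli (R : realType) (N : nat) (zeta : 'I_N.+1 -> R)
    (P : probability (Omega N) R) : Prop :=
  forall (v : nat -> 'I_N.+1) (n : nat),
    P (cylinder v n) = (\prod_(k < n) zeta (v k))%:E.

Section OneVariable.
Context (R : realType) (d : nat).
Implicit Types (X : set 'rV[R]_d) (mu nu : set (borelRd R d) -> \bar R).

Definition lip1 X : set ('rV[R]_d -> R) :=
  [set phi | forall x y, X x -> X y -> `|phi x - phi y| <= enorm (x - y)].

Definition monge_kantorovich X mu nu : \bar R :=
  ereal_sup [set (\int[mu]_(x in X) (phi x)%:E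
                  - \int[nu]_(x in X) (phi x)%:E)%E | phi in lip1 X].

Context (N : nat) (I : 'I_N.+1 -> finType).
Context (S : forall i, I i -> 'rV[R]_d -> 'rV[R]_d) (p : forall i, I i -> R).

(* The maps only matter on X, hence preimages are taken within X. *)
Definition rss_approx X (w : nat -> 'I_N.+1) nu (n : nat) :
    set (borelRd R d) -> \bar R :=
  fun A => (\sum_(s : {dffun forall k : 'I_n, I (w k)})
    (\prod_(k < n) p (s k))%:E
    * nu (X `&` (\big[comp/id]_(k < n) S (s k)) @^-1` A))%E.

Definition is_rss_measure X (w : nat -> 'I_N.+1)
    (m : probability (borelRd R d) R) : Prop :=
  m X = 1%E /\
  forall nu : probability (borelRd R d) R, nu X = 1%E ->
    monge_kantorovich X (rss_approx X w nu n) m @[n --> \oo] --> 0%E.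

Definition uessc X : Prop :=
  exists2 beta : R, 0 < beta &
    forall (i : 'I_N.+1) (j j' : I i), j != j' ->
      beta * \big[Num.max/0]_(k : I i) diam (S k @` X)
        <= set_dist (S j @` X) (S j' @` X).

End OneVariable.

Section Quantization.
Context (R : realType) (d : nat).
Local Open Scope ereal_scope.

(* Extended-valued, so that the distance to the empty set is [+oo]. *)
Definition point_dist (x : 'rV[R]_d) (alpha : set 'rV[R]_d) : \bar R :=
  ereal_inf [set (enorm (x - a)%R)%:E | a in alpha].

Definition quant_error (r : R) (mu : probability (borelRd R d) R) (n : nat) :
    \bar R :=
  ereal_inf [set \int[mu]_x poweR (point_dist x alpha) r
            | alpha in [set alpha : set 'rV[R]_d | (alpha #<= `I_n)%card]].

(* When [quant_error r mu n = 0] the denominator is [+oo] and the quotient is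
   0. *)
Definition quant_ratio (r : R) (mu : probability (borelRd R d) R) (n : nat) :
    \bar R :=
  (r * ln n%:R)%:E / (- lne (quant_error r mu n)).

Definition lower_quant_dim (r : R) (mu : probability (borelRd R d) R) :=
  limn_einf (quant_ratio r mu).

Definition upper_quant_dim (r : R) (mu : probability (borelRd R d) R) :=
  limn_esup (quant_ratio r mu).

Definition has_quant_dim (r : R) (mu : probability (borelRd R d) R)
    (D : \bar R) : Prop :=
  lower_quant_dim r mu = D /\ upper_quant_dim r mu = D.

End Quantization.

(* Main.v *)
Require Import Defs.
From mathcomp Require Import all_boot all_order all_algebra.
From mathcomp Require Import all_classical all_reals all_analysis.
From mathcomp Require Import measurable_realfun.
From mathcomp Require Import ring lra.

Set Implicit Arguments.
Unset Strict Implicit.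
Unset Printing Implicit Defensive.

Import Order.TTheory GRing.Theory Num.Theory.
Import numFieldNormedType.Exports.

Local Open Scope classical_set_scope.
Local Open Scope ring_scope.

(** Put [s = kappa / (r + kappa)] and [h_j = p_j c_j ^ r].  Stopping every word
    along [w] as soon as its weight [h] drops below [eps] gives a finite set of
    cells carrying mass [p] and of diameter [c * diam X].  The weights
    [h ^ s / Q_n], where [Q_n] is the product over [k < n] of the sums
    [\sum_j h_j ^ s] at the letter [w_k], are probability vectors, so they sum to
    1 over the cells; since [\sum_(k < n) ln (\sum_j h_j ^ s) = o(n)] almost
    surely (strong law of large numbers), the number [M] of cells is
    [eps ^ (- s + o(1))].  One centre in each cell shows that the quantization
    error with [M] points is at most of order [M * eps].  Conversely, by the
    separation condition each point of a codebook is close to at most one cell,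
    so with [M / 2] points half of the cells remain far from the codebook and the
    error is at least of order [M * eps].  Both bounds are [M ^ (- r / kappa +
    o(1))]. *)

(** * Euclidean geometry and Borel sets *)

Section EuclideanNorm.
Context {R : realType} {d : nat}.
Implicit Types x y z : 'rV[R]_d.

Lemma enorm_ge0 x : 0 <= enorm x.
Proof. exact: sqrtr_ge0. Qed.

Lemma enormN x : enorm (- x) = enorm x.
Proof. by rewrite /enorm; under eq_bigr do rewrite mxE sqrrN. Qed.

Lemma enorm0 : enorm (0 : 'rV[R]_d) = 0.
Proof.
by rewrite /enorm big1 ?sqrtr0// => i _; rewrite mxE expr0n.
Qed.

Lemma enormC x y : enorm (x - y) = enorm (y - x).
Proof. by rewrite -enormN opprB. Qed.

Lemma sqr_enorm x : enorm x ^+ 2 = \sum_(i < d) x ord0 i ^+ 2.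
Proof. by rewrite sqr_sqrtr// sumr_ge0// => i _; exact: sqr_ge0. Qed.

Lemma abs_coord_le_enorm x i : `|x ord0 i| <= enorm x.
Proof.
rewrite -sqrtr_sqr /enorm ler_wsqrtr// (bigD1 i)//= lerDl sumr_ge0// => j _.
exact: sqr_ge0.
Qed.

Lemma enorm_eq0 x : enorm x = 0 -> x = 0.
Proof.
move=> x0; apply/rowP => i; rewrite mxE; apply/eqP; rewrite -normr_eq0.
by rewrite eq_le normr_ge0 andbT -x0 abs_coord_le_enorm.
Qed.

(** The sum of the squares of [enorm y * x ord0 i - enorm x * y ord0 i] is nonnegative and expands
    to [2 * enorm x * enorm y] times the difference of the two sides. The cases where a norm
    vanishes are treated apart, so that this factor can be cancelled. *)
Lemma cauchy_schwarz x y :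
  \sum_(i < d) x ord0 i * y ord0 i <= enorm x * enorm y.
Proof.
have [/enorm_eq0 ->|x0] := eqVneq (enorm x) 0.
  by rewrite enorm0 mul0r big1// => i _; rewrite mxE mul0r.
have {}x0 : 0 < enorm x by rewrite lt_neqAle eq_sym x0 enorm_ge0.
have : 0 <= \sum_(i < d) (enorm y * x ord0 i - enorm x * y ord0 i) ^+ 2.
  by apply: sumr_ge0 => i _; exact: sqr_ge0.
have -> : \sum_(i < d) (enorm y * x ord0 i - enorm x * y ord0 i) ^+ 2 =
    enorm y ^+ 2 * (\sum_(i < d) x ord0 i ^+ 2)
    + enorm x ^+ 2 * (\sum_(i < d) y ord0 i ^+ 2)
    - 2 * enorm x * enorm y * \sum_(i < d) x ord0 i * y ord0 i.
  rewrite !mulr_sumr -big_split /= -sumrB; apply: eq_bigr => i _; ring.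
rewrite -!sqr_enorm; have := enorm_ge0 y; rewrite le_eqVlt => /predU1P[y0|y0].
  have /enorm_eq0 -> : enorm y = 0 by [].
  by move=> _; rewrite enorm0 mulr0 big1// => i _; rewrite mxE mulr0.
have xy : 0 < 2 * enorm x * enorm y by rewrite !mulr_gt0.
move=> h; rewrite -(ler_pM2l xy) -subr_ge0; apply: le_trans h _.
by rewrite le_eqVlt; apply/orP; left; apply/eqP; ring.
Qed.

Lemma enorm_triangle x y : enorm (x + y) <= enorm x + enorm y.
Proof.
rewrite -(@ler_pXn2r _ 2)// ?nnegrE ?addr_ge0 ?enorm_ge0//.
rewrite sqr_enorm.
have -> : \sum_(i < d) (x + y) ord0 i ^+ 2 =
    enorm x ^+ 2 + enorm y ^+ 2 + 2 * \sum_(i < d) x ord0 i * y ord0 i.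
  rewrite !sqr_enorm mulr_sumr -!big_split /=; apply: eq_bigr => i _.
  by rewrite mxE; ring.
have := cauchy_schwarz x y; nra.
Qed.

Lemma enorm_dist_triangle x y z : enorm (x - z) <= enorm (x - y) + enorm (y - z).
Proof. by apply: le_trans (enorm_triangle _ _); rewrite addrA subrK. Qed.

Lemma enorm_continuous : continuous (@enorm R d).
Proof.
move=> x; apply: (@continuous_comp _ _ _ (fun x : 'rV[R]_d =>
  \sum_(i < d) x ord0 i ^+ 2) (@Num.sqrt R)); last exact: sqrt_continuous.
apply: continuous_big => [|i _ y]; first exact: add_continuous.
have c : (fun M : 'rV[R]_d => M ord0 i) M @[M --> y] --> y ord0 i.
  exact: (@coord_continuous R 1 d ord0 i).
rewrite /continuous_at expr2; under eq_fun do rewrite expr2; apply: (cvgM c c).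
Qed.

(** With [ball_enorm], this passes between Euclidean estimates and the topology of the library,
    whose balls are those of the sup norm. *)
Lemma near_enorm x e : 0 < e -> \forall y \near x, enorm (y - x) < e.
Proof.
move=> e0; have : (fun y => enorm (y - x)) y @[y --> x] --> enorm (x - x).
  apply: (@continuous_comp _ _ _ (fun y => y - x) (@enorm R d)).
    by apply: (@cvgB R 'rV[R]_d _ (nbhs x) _ id (cst x) x x cvg_id (cvg_cst x)).
  exact: enorm_continuous.
rewrite subrr enorm0 => /cvgr_dist_lt /(_ _ e0).
by apply: filterS => y; rewrite sub0r normrN ger0_norm ?enorm_ge0.
Qed.

Lemma ball_enorm x y e : enorm (x - y) < e -> ball x e y.
Proof.
move=> xye; split=> [|i j]; first by rewrite (le_lt_trans _ xye)// enorm_ge0.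
rewrite /ball/= /ball_ /= !ord1; apply: le_lt_trans xye.
by have := abs_coord_le_enorm (x - y) j; rewrite !mxE.
Qed.

End EuclideanNorm.

Section LipschitzContinuity.
Context {R : realType} {d : nat}.

Lemma lipschitz_within_continuous {e : nat} (A : set 'rV[R]_d) (k : R)
    (f : 'rV[R]_d -> 'rV[R]_e) : 0 < k ->
  (forall x y, A x -> A y -> enorm (f x - f y) <= k * enorm (x - y)) ->
  {within A, continuous f}.
Proof.
move=> k0 kf; apply/subspace_continuousP => x Ax; apply/cvg_ballP => e0 e00.
rewrite near_withinE; have := @near_enorm _ _ x _ (divr_gt0 e00 k0).
apply: filterS => y yx Ay; apply: ball_enorm.
apply: le_lt_trans (kf _ _ _ _) _ => //.
by rewrite enormC mulrC -ltr_pdivlMr.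
Qed.

Lemma lip1_within_continuous (A : set 'rV[R]_d) (phi : 'rV[R]_d -> R) :
  lip1 A phi -> {within A, continuous phi}.
Proof.
move=> Aphi; apply/subspace_continuousP => x Ax; apply/cvgrPdist_lt => e0 e00.
rewrite near_withinE; have := @near_enorm _ _ x _ e00.
apply: filterS => y yx Ay; apply: le_lt_trans (Aphi _ _ _ _) _ => //.
by rewrite enormC.
Qed.

Lemma open_borel (A : set (borelRd R d)) :
  open (A : set 'rV[R]_d) -> measurable A.
Proof. exact: sub_sigma_algebra. Qed.

Lemma compact_borel (A : set (borelRd R d)) :
  compact (A : set 'rV[R]_d) -> measurable A.
Proof.
move=> /compact_closed cA; rewrite -[A]setCK; apply: measurableC.
by apply: open_borel; rewrite openC; apply: cA; exact: norm_hausdorff.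
Qed.

Lemma within_continuous_borel (A : set (borelRd R d))
    (phi : borelRd R d -> R) : measurable A ->
  {within (A : set 'rV[R]_d), continuous (phi : 'rV[R]_d -> R)} ->
  measurable_fun A phi.
Proof.
move=> mA /continuousP cf; apply: (measurability _ (RGenOpens.measurableE R)).
move=> _ [_ [a [b ->] <-]].
have oab : open (`]a, b[%classic : set R) by exact: interval_open.
have ocf : open ((phi @^-1` `]a, b[) : set (subspace (A : set 'rV[R]_d))).
  exact: cf oab.
have [U oU UA] := (open_subspaceP _ _).1 ocf.
rewrite setIC -UA; apply: measurableI => //; exact: open_borel.
Qed.

Lemma lip1_borel (A : set (borelRd R d)) (phi : borelRd R d -> R) :
  measurable A -> lip1 (A : set 'rV[R]_d) phi -> measurable_fun A phi.
Proof.
by move=> mA /lip1_within_continuous; exact: within_continuous_borel.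
Qed.

End LipschitzContinuity.

(** * Distance to a set and Lipschitz test functions *)

Section Infdist.
Context {R : realType} {d : nat}.
Implicit Types (x y : 'rV[R]_d) (A : set 'rV[R]_d).

(** Real-valued, unlike [point_dist]: on the empty set [inf] takes a default value, whence the
    nonemptiness assumptions below. *)
Definition infdist A x : R := inf [set enorm (x - a) | a in A].

Lemma infdist_le A x a : A a -> infdist A x <= enorm (x - a).
Proof.
move=> Aa; apply: ge_inf; last by exists a.
by exists 0 => _ [b _ <-]; exact: enorm_ge0.
Qed.

Lemma infdist_ge A x (k : R) : A !=set0 ->
  (forall a, A a -> k <= enorm (x - a)) -> k <= infdist A x.
Proof.
move=> [a Aa] kA; apply: lb_le_inf; first by exists (enorm (x - a)); exists a.
by move=> _ [b Ab <-]; exact: kA.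
Qed.

Lemma infdist_ge0 A x : A !=set0 -> 0 <= infdist A x.
Proof. by move=> A0; apply: infdist_ge => // a _; exact: enorm_ge0. Qed.

Lemma infdist_mem A x : A x -> infdist A x = 0.
Proof.
move=> Ax; apply/eqP; rewrite eq_le infdist_ge0 ?andbT; last by exists x.
by apply: le_trans (infdist_le _ Ax) _; rewrite subrr enorm0.
Qed.

Lemma infdist_lip A (B : set 'rV[R]_d) : A !=set0 -> lip1 B (infdist A).
Proof.
move=> A0 x y _ _.
suff h u v : infdist A u - infdist A v <= enorm (u - v).
  by rewrite ler_norml h andbT lerNl opprB enormC h.
rewrite lerBlDr -lerBlDl; apply: infdist_ge => // a Aa.
rewrite lerBlDl; apply: le_trans (infdist_le _ Aa) _.
exact: enorm_dist_triangle.
Qed.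

Lemma infdist_eq0 A x : compact A -> A !=set0 -> infdist A x = 0 -> A x.
Proof.
move=> cA A0 Ax0; have clA : closed A.
  by apply: compact_closed cA; exact: norm_hausdorff.
apply: clA => U; rewrite -nbhs_ballE => -[e /= e0 eU].
have [|_ [a Aa <-] ae] := @inf_adherent _ [set enorm (x - a) | a in A] e e0.
  split; first by case: A0 => a Aa; exists (enorm (x - a)); exists a.
  by exists 0 => _ [b _ <-]; exact: enorm_ge0.
exists a; split=> //; apply: eU; apply: ball_enorm.
by move: ae; rewrite -/(infdist A x) Ax0 add0r.
Qed.

(** Truncated distances to unions of cells are the test functions fed to the Monge-Kantorovich
    metric below. *)
Lemma min_lip1 (B : set 'rV[R]_d) (k : R) phi :
  lip1 B phi -> lip1 B (fun x => Num.min k (phi x)).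
Proof.
move=> Bphi x y Bx By; apply: le_trans (Bphi x y Bx By).
have h1 := ler_norm (phi x - phi y); have h2 := ler_norm (phi y - phi x).
rewrite distrC in h2; rewrite ler_norml /Num.min.
by do 2 case: ltP => ?; apply/andP; split; lra.
Qed.

End Infdist.

(** * A strong law of large numbers for Bernoulli sequences *)

Lemma measure_bigsetU_le {d} {T : measurableType d} {R : realType}
    (mu : {measure set T -> \bar R}) {K : Type} (s : seq K) (Q : pred K)
    (F : K -> set T) : (forall i, Q i -> measurable (F i)) ->
  (mu (\big[setU/set0]_(i <- s | Q i) F i) <= \sum_(i <- s | Q i) mu (F i))%E.
Proof.
move=> mF; elim: s => [|i s ih]; first by rewrite !big_nil measure0.
rewrite !big_cons; case: ifPn => // Qi.
apply: le_trans (measureU2 _ _ _) _ => //; [exact: mF| |exact: leeD2l].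
by apply: bigsetU_measurable => j; exact: mF.
Qed.

Lemma ae_foralln {d} {T : measurableType d} {R : realType}
    (mu : {measure set T -> \bar R}) (Q : nat -> T -> Prop) :
  (forall n, \forall x \ae mu, Q n x) -> \forall x \ae mu, forall n, Q n x.
Proof.
move=> h; apply: negligibleS (negligible_bigcup h) => x /= /existsNP[n Qn].
by exists n.
Qed.

Section SublinearSums.
Context {R : realType} {N : nat}.
Implicit Types (zeta g : 'I_N.+1 -> R) (w : nat -> 'I_N.+1).

(** From [1 - x <= expR (- x)] one gets [expR x * (1 - x) <= 1], and the right-hand side times
    [1 - x] is [1 + x ^+ 2 * (1 - 2 * x)], at least 1. *)
Lemma expR_le_quadratic (x : R) : x <= 2^-1 -> expR x <= 1 + x + 2 * x ^+ 2.
Proof.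
move=> x2; have : 1 - x <= (expR x)^-1 by rewrite -expRN; exact: expR_ge1Dx.
rewrite -(ler_pM2l (expR_gt0 x)) divff ?gt_eqF ?expR_gt0// => h.
have x1 : 0 < 1 - x by lra.
rewrite -(ler_pM2r x1); apply: le_trans h _; nra.
Qed.

(** To first order the moment is [1 - t * eta], as [g] has mean zero. If [B] bounds [g - eta], the
    quadratic correction is at most [2 * (t * B) ^+ 2], which is half of [t * eta] for
    [t = eta / (4 * B ^+ 2)]. *)
Lemma exp_moment_lt1 zeta g (eta : R) : (forall i, 0 <= zeta i) ->
  \sum_i zeta i = 1 -> \sum_i zeta i * g i = 0 -> 0 < eta ->
  exists2 t : R, 0 < t & \sum_i zeta i * expR (t * (g i - eta)) < 1.
Proof.
move=> zeta0 zeta1 zg eta0.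
(* The summands [eta + 1] make [B] positive and at least [eta]; hence [t * B <= 4^-1], within the
   range of [expR_le_quadratic]. *)
pose B := \sum_i `|g i - eta| + eta + 1.
have s0 : 0 <= \sum_i `|g i - eta| by apply: sumr_ge0.
have B0 : 0 < B by rewrite /B; lra.
have gB i : `|g i - eta| <= B.
  by rewrite /B (bigD1 i)//= -!addrA lerDl !addr_ge0 ?sumr_ge0 ?(ltW eta0).
pose t := eta / (4 * B ^+ 2).
have B20 : 0 < 4 * B ^+ 2 by rewrite mulr_gt0// exprn_gt0.
have t0 : 0 < t by rewrite divr_gt0.
have tB : t * (4 * B ^+ 2) = eta by rewrite /t divfK// gt_eqF.
have tB1 : t * B <= 4^-1.
  rewrite -(ler_pM2r B0); have : eta <= B by rewrite /B; lra.
  rewrite -tB expr2; lra.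
exists t => //.
apply: (@le_lt_trans _ _ (\sum_i zeta i *
    (1 + t * (g i - eta) + 2 * (t * B) ^+ 2))).
  apply: ler_sum => i _; apply: ler_wpM2l => //.
  have := gB i; rewrite ler_norml => /andP[gB1 gB2].
  have tg : t * (g i - eta) <= t * B by rewrite ler_pM2l.
  have tg' : - (t * B) <= t * (g i - eta) by rewrite -mulrN ler_pM2l.
  apply: le_trans (expR_le_quadratic _) _; first lra.
  by rewrite lerD2l; nra.
have -> : \sum_i zeta i * (1 + t * (g i - eta) + 2 * (t * B) ^+ 2) =
   (1 - t * eta + 2 * (t * B) ^+ 2) * (\sum_i zeta i)
   + t * \sum_i zeta i * g i.
  rewrite !mulr_sumr -big_split /=; apply: eq_bigr => i _; ring.
rewrite zeta1 zg mulr0 addr0 mulr1.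
suff : 2 * (t * B) ^+ 2 < t * eta by lra.
have := mulr_gt0 t0 (mulr_gt0 t0 (exprn_gt0 2 B0)).
rewrite -tB; nra.
Qed.

(** Cylinders are named by infinite sequences; the padding with [ord0] is invisible to
    [cylinder _ n]. *)
Definition extend n (v : {ffun 'I_n -> 'I_N.+1}) : nat -> 'I_N.+1 :=
  fun k => if insub k is Some i then v i else ord0.

Lemma extendE n (v : {ffun 'I_n -> 'I_N.+1}) (i : 'I_n) : extend v i = v i.
Proof. by rewrite /extend valK. Qed.

Let cylinder_measurable v n : measurable (cylinder v n : set (Omega N)).
Proof. by apply: sub_sigma_algebra; exists v, n. Qed.

Let large_sum g (eta : R) n : set (Omega N) :=
  [set w | eta * n%:R <= \sum_(k < n) g ((w : nat -> 'I_N.+1) k)].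

(** The event depends on the first [n] letters only, so its measurability and its probability reduce
    to those of finitely many cylinders. *)
Let large_sumE g eta n : large_sum g eta n =
  \big[setU/set0]_(v : {ffun 'I_n -> 'I_N.+1} |
    eta * n%:R <= \sum_(k < n) g (v k)) cylinder (extend v) n.
Proof.
rewrite -bigcup_seq_cond; apply/seteqP; split=> w /=.
  move=> h; exists [ffun k : 'I_n => w k] => /=.
    rewrite mem_index_enum/=; apply: le_trans h _; rewrite le_eqVlt.
    by apply/orP; left; apply/eqP; apply: eq_bigr => k _; rewrite ffunE.
  by move=> k kn; rewrite (extendE _ (Ordinal kn)) ffunE.
move=> [v /= /andP[_ h] vw]; apply: le_trans h _; rewrite le_eqVlt.
apply/orP; left; apply/eqP; apply: eq_bigr => k _.
by rewrite vw// extendE.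
Qed.

Let large_sum_measurable g eta n : measurable (large_sum g eta n).
Proof.
rewrite large_sumE; apply: bigsetU_measurable => v _.
exact: cylinder_measurable.
Qed.

Context {zeta : 'I_N.+1 -> R} {P : probability (Omega N) R}.
Hypotheses (zeta0 : forall i, 0 <= zeta i) (zeta1 : \sum_i zeta i = 1).
Hypothesis P_bernoulli : is_bernoulli zeta P.

(* Markov's inequality applied to [expR (t * \sum_(k < n) (g (w k) - eta))]. *)
Let large_sum_le g eta t n : 0 < t ->
  (P (large_sum g eta n) <=
    ((\sum_i zeta i * expR (t * (g i - eta))) ^+ n)%:E)%E.
Proof.
move=> t0; rewrite large_sumE; apply: le_trans (measure_bigsetU_le _ _ _) _.
  by move=> v _; exact: cylinder_measurable.
rewrite (eq_bigr (fun v : {ffun 'I_n -> 'I_N.+1} =>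
  (\prod_(k < n) zeta (v k))%:E)); last first.
  move=> v _; apply: etrans (P_bernoulli _ _) _; congr EFin.
  apply: eq_bigr => k _; by rewrite extendE.
(* The [n]-th power is expanded into a sum over all words of length [n]; words outside the event
   contribute nonnegative terms, and on the event the exponential factor is at least 1. *)
rewrite sumEFin lee_fin -[X in _ ^+ X]card_ord -prodr_const bigA_distr_bigA /=.
rewrite [leRHS](bigID (fun v : {ffun 'I_n -> 'I_N.+1} =>
  eta * n%:R <= \sum_(k < n) g (v k))) /= ler_wpDr//.
  by apply: sumr_ge0 => v _; apply: prodr_ge0 => k _; rewrite mulr_ge0 ?expR_ge0.
apply: ler_sum => v h; rewrite big_split /=; rewrite ler_peMr//.
  by apply: prodr_ge0.
rewrite -expR_sum -[leLHS]expR0 ler_expR -mulr_sumr mulr_ge0 ?(ltW t0)//.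
by rewrite sumrB sumr_const card_ord -mulr_natr subr_ge0.
Qed.

(** Borel-Cantelli: the probabilities are dominated by a geometric series of ratio [rho < 1], so the
    limsup of the events is null. *)
Let eventually_small_sum g eta : \sum_i zeta i * g i = 0 -> 0 < eta ->
  {ae P, forall w : Omega N, \forall n \near \oo,
     \sum_(k < n) g ((w : nat -> 'I_N.+1) k) < eta * n%:R}.
Proof.
move=> zg eta0; have [t t0] := exp_moment_lt1 zeta0 zeta1 zg eta0.
set rho := (X in X < 1) => rho1.
have rho0 : 0 <= rho by apply: sumr_ge0 => i _; rewrite mulr_ge0 ?expR_ge0.
exists (lim_sup_set (large_sum g eta)); split.
- by apply: bigcap_measurable => // n _; apply: bigcup_measurable.
- apply: lim_sup_set_cvg0 => //.
  apply: (@le_lt_trans _ _ (\sum_(n <oo) (rho ^+ n)%:E)%E).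
    by apply: lee_nneseries => // n _; exact: large_sum_le.
  have : (\sum_(0 <= n < k) (rho ^+ n)%:E)%E @[k --> \oo] --> ((1 - rho)^-1)%:E.
    under eq_fun do rewrite sumEFin; apply: cvg_EFin; first exact: nearW.
    have := @cvg_geometric_series R 1 rho; rewrite mul1r ger0_norm//.
    move=> /(_ rho1); apply: cvg_trans; apply: near_eq_cvg; apply: nearW => k.
    by rewrite /series /geometric /=; apply: eq_bigr => i _; rewrite mul1r.
  by move/cvg_lim => ->//; rewrite ltry.
- move=> w /= h n _; apply: contrapT => hn; apply: h; exists n => // k /= nk.
  rewrite ltNge; apply/negP => gk; apply: hn; exists k => //.
Qed.

(** The one-sided estimate is applied to [g] and [- g] for the countably many thresholds
    [m.+1%:R^-1], which gives one null set valid for every [eta]. *)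
Lemma ae_sublinear_sums g : \sum_i zeta i * g i = 0 ->
  {ae P, forall w : Omega N, forall eta, 0 < eta -> exists C, forall n,
     `|\sum_(k < n) g ((w : nat -> 'I_N.+1) k)| <= C + eta * n%:R}.
Proof.
move=> zg.
have zNg : \sum_i zeta i * (- g i) = 0.
  by under eq_bigr do rewrite mulrN; rewrite sumrN zg oppr0.
have inv0 (m : nat) : 0 < m.+1%:R^-1 :> R by rewrite invr_gt0.
have : {ae P, forall w : Omega N, forall m : nat, \forall n \near \oo,
    `|\sum_(k < n) g ((w : nat -> 'I_N.+1) k)| <= m.+1%:R^-1 * n%:R}.
  apply/ae_foralln => m; have := eventually_small_sum zNg (inv0 m).
  have := eventually_small_sum zg (inv0 m).
  apply: filterS2 => w; apply: filterS2 => n h1.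
  rewrite sumrN => h2; rewrite ler_norml; apply/andP; split; last exact: ltW.
  by rewrite lerNl ltW.
apply: filterS => w h eta eta0.
have [m meta] : exists m : nat, m.+1%:R^-1 <= eta.
  exists (Num.trunc eta^-1); rewrite -[leRHS]invrK lef_pV2 ?posrE ?invr_gt0//.
  by rewrite ltW// truncnS_gt.
have [n0 _ hn0] := h m.
(* This constant dominates each of the finitely many partial sums before [n0]. *)
exists (\sum_(j < n0) `|\sum_(k < j) g ((w : nat -> 'I_N.+1) k)|) => n.
have [n0n|nn0] := leqP n0 n.
  apply: le_trans (hn0 n n0n) _; rewrite -[leLHS]add0r lerD//.
    exact: sumr_ge0.
  by rewrite ler_wpM2r.
rewrite (bigD1 (Ordinal nn0))//= -addrA lerDl addr_ge0 ?sumr_ge0//.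
by rewrite mulr_ge0 ?(ltW eta0).
Qed.

End SublinearSums.

(** * Words and stopping cuts *)

Section Words.
Context {R : realType} {N : nat} {I : 'I_N.+1 -> finType}.
Local Notation letter := {i : 'I_N.+1 & I i}.
Implicit Types (h q : letter -> R) (w : nat -> 'I_N.+1) (s : seq letter).

Definition shift w : nat -> 'I_N.+1 := fun k => w k.+1.

Definition word_prod q s : R := \prod_(a <- s) q a.

Lemma word_prod_cons q a s : word_prod q (a :: s) = q a * word_prod q s.
Proof. by rewrite /word_prod big_cons. Qed.

Lemma word_prod_nil q : word_prod q [::] = 1.
Proof. by rewrite /word_prod big_nil. Qed.

Lemma word_prod_gt0 q s : (forall a, 0 < q a) -> 0 < word_prod q s.
Proof. by move=> q0; rewrite /word_prod prodr_gt0. Qed.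

(* The words along [w] at which the product of the weights first drops below
   [eps], truncated at length [n]. *)
Fixpoint cut h (n : nat) w (eps : R) : seq (seq letter) :=
  if n is m.+1 then
    if 1 < eps then [:: [::]]
    else flatten [seq [seq Tagged I j :: s
                      | s <- cut h m (shift w) (eps / h (Tagged I j))]
                 | j <- enum (I (w 0%N))]
  else [:: [::]].

Variant cut_spec h n w eps s : Prop :=
| CutNil of s = [::] & (n == 0%N) || (1 < eps)
| CutCons m j s' of n = m.+1 & eps <= 1 & s = @Tagged _ (w 0%N) I j :: s' &
    s' \in cut h m (shift w) (eps / h (Tagged I j)).

Lemma cutP h n w eps s : s \in cut h n w eps -> cut_spec h n w eps s.
Proof.
case: n => [|n] /=; first by rewrite inE => /eqP ->; exact: CutNil.
case: ltP => eps1; first by rewrite inE => /eqP ->; apply: CutNil.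
by move=> /flatten_mapP[j _ /mapP[s' s'cut ->]]; exact: CutCons s'cut.
Qed.

Lemma uniq_cut h n w eps : uniq (cut h n w eps).
Proof.
elim: n w eps => [//|n ih] w eps /=; case: ltP => // _.
elim: (enum _) (enum_uniq (I (w 0%N))) => [//|j l ihl] /= /andP[jl ul].
rewrite cat_uniq ihl// andbT map_inj_uniq ?ih ?andTb; last by move=> s s' [].
apply/hasPn => _ /flatten_mapP[j' j'l /mapP[s _ ->]].
apply/negP => /mapP[s' _] [] /eqP.
rewrite -[X in is_true X]/(Tagged I j' == Tagged I j).
by rewrite eq_Tagged /= => /eqP jj' _; move: jl; rewrite -jj' j'l.
Qed.

Lemma size_cut h n w eps s : s \in cut h n w eps -> (size s <= n)%N.
Proof.
elim: n w eps s => [|n ih] w eps s /cutP[->//|m j s' //] [<-] _ -> /ih.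
by rewrite ltnS.
Qed.

(** The letters of a cut word have the tags of [w], so a weight depending on the tag alone gives a
    product that depends only on the length. *)
Lemma cut_tags h n w eps s (t : 'I_N.+1 -> R) : s \in cut h n w eps ->
  word_prod (t \o tag) s = \prod_(k < size s) t (w k).
Proof.
elim: n w eps s => [|n ih] w eps s /cutP[->|m j s' //].
- by rewrite word_prod_nil big_ord0.
- by rewrite word_prod_nil big_ord0.
by move=> [<-] _ -> /ih; rewrite word_prod_cons /= big_ord_recl => ->.
Qed.

(** In the recursion the threshold is divided by each weight read, so a letter is added only while
    the current product is at least the original [eps]; the last letter then costs at most a factor
    [hmin]. *)
Lemma cut_weight_ge h n w eps s (hmin : R) : 0 < hmin ->
  (forall a, hmin <= h a) -> hmin * eps <= 1 ->
  s \in cut h n w eps -> hmin * eps <= word_prod h s.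
Proof.
move=> hmin0 hminh; have h0 a : 0 < h a by exact: lt_le_trans (hminh a).
elim: n w eps s => [|n ih] w eps s eps1 /cutP[->|m j s' //].
- by rewrite word_prod_nil.
- by rewrite word_prod_nil.
move=> [<-] eps1' -> /ih; rewrite word_prod_cons mulrA mulrC ler_pdivrMl//.
rewrite mulr1 => H; rewrite mulrC in H; rewrite -ler_pdivrMl// mulrC.
apply: H; apply: le_trans (hminh _); rewrite ler_piMr// ltW//.
Qed.

(** A word stopped by the threshold has weight below [eps]; a word truncated at length [n] has
    weight at most [hmax ^+ n]. *)
Lemma cut_weight_le h n w eps s (hmax : R) : (forall a, 0 < h a <= hmax) ->
  hmax ^+ n <= eps -> s \in cut h n w eps -> word_prod h s <= eps.
Proof.
move=> hh; have h0 a : 0 < h a by case/andP: (hh a).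
elim: n w eps s => [|n ih] w eps s eps1 /cutP[->|m j s' //].
- by rewrite word_prod_nil -(expr0 hmax).
- by rewrite word_prod_nil => /ltW.
move=> [<-] _ -> /ih H; rewrite word_prod_cons -ler_pdivlMl// mulrC; apply: H.
rewrite ler_pdivlMr//; apply: le_trans eps1; rewrite exprSr.
have /andP[_ hj] := hh (Tagged I j).
rewrite ler_wpM2l// exprn_ge0//; apply: le_trans hj; exact: ltW.
Qed.

Section Mean.
Context {V : Type}.
Variables (q : letter -> R) (f : letter -> V -> V) (X : set V) (x0 : V).
Hypothesis q1 : forall i, \sum_(j : I i) q (Tagged I j) = 1.
Hypothesis fX : forall a x, X x -> X (f a x).
Hypothesis Xx0 : X x0.

Definition word_map s : V -> V := \big[comp/id]_(a <- s) f a.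

Lemma word_map_cons a s x : word_map (a :: s) x = f a (word_map s x).
Proof. by rewrite /word_map big_cons. Qed.

Lemma word_map_mem s x : X x -> X (word_map s x).
Proof.
move=> Xx; elim: s => [|a s ih]; first by rewrite /word_map big_nil.
by rewrite word_map_cons; exact: fX.
Qed.

(* The integral of [phi] against the [n]-th approximating measure started from
   the Dirac mass at [x0]. *)
Fixpoint mean (n : nat) w (phi : V -> R) : R :=
  if n is m.+1 then
    \sum_(j : I (w 0%N)) q (Tagged I j) * mean m (shift w) (phi \o f (Tagged I j))
  else phi x0.

Lemma mean_const n w phi k : (forall x, X x -> phi x = k) -> mean n w phi = k.
Proof.
elim: n w phi => [|n ih] w phi phik /=; first exact: phik.
rewrite -[RHS]mul1r -(q1 (w 0%N)) mulr_suml; apply: eq_bigr => j _.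
by rewrite ih// => x Xx /=; rewrite phik//; exact: fX.
Qed.

(** Every word of length [n] along [w] has a prefix in the cut. If [phi] is constant on each cell,
    averaging over the continuations of a prefix changes nothing, since each [q] sums to 1; the mean
    is thus the same for all [n >= k]. *)
Lemma mean_cut h n k w eps phi (v : seq letter -> R) : (k <= n)%N ->
  (forall s x, s \in cut h k w eps -> X x -> phi (word_map s x) = v s) ->
  mean n w phi = \sum_(s <- cut h k w eps) word_prod q s * v s.
Proof.
elim: k n w eps phi v => [|k ih] n w eps phi v.
  move=> _ phiv; rewrite /= big_seq1 word_prod_nil mul1r; apply: mean_const => x.
  by move=> /(phiv _ _ (mem_head _ _)); rewrite /word_map big_nil.
case: n => // n kn /=; case: ltP => eps1 phiv.
  rewrite big_seq1 word_prod_nil mul1r.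
  apply: (@mean_const n.+1) => x.
  by move=> /(phiv _ _ (mem_head _ _)); rewrite /word_map big_nil.
rewrite big_flatten big_map big_enum /=; apply: eq_bigr => j _.
rewrite big_map.
rewrite (ih _ _ (eps / h (Tagged I j)) _ (fun s => v (Tagged I j :: s)))//.
  by rewrite mulr_sumr; apply: eq_bigr => s _; rewrite word_prod_cons mulrA.
move=> s x scut Xx /=; rewrite -word_map_cons; apply: phiv => //.
by apply/flatten_mapP; exists j; rewrite ?mem_enum//; apply: map_f.
Qed.

End Mean.

(** This is [mean_cut] on the one-point space with the constant test function 1. *)
Lemma sum_word_prod_cut h q n w eps :
  (forall i, \sum_(j : I i) q (Tagged I j) = 1) ->
  \sum_(s <- cut h n w eps) word_prod q s = 1.
Proof.
move=> q1; under eq_bigr do rewrite -[word_prod q _]mulr1.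
have := @mean_cut unit q (fun=> id) setT tt q1 _ _ h n n w eps (cst 1) (cst 1).
by move=> <-//; apply: (@mean_const _ _ _ setT).
Qed.

End Words.

(** * Compositions of similitudes and separation of cells *)

Section Similitudes.
Context {R : realType} {N d : nat} {I : 'I_N.+1 -> finType}.
Local Notation letter := {i : 'I_N.+1 & I i}.
Variables (f : letter -> 'rV[R]_d -> 'rV[R]_d) (c : letter -> R).
Variable X : set 'rV[R]_d.
Hypothesis fX : forall a x, X x -> X (f a x).
Hypothesis c01 : forall a, 0 < c a < 1.
Hypothesis f_sim : forall a x y, X x -> X y ->
  enorm (f a x - f a y) = c a * enorm (x - y).

Lemma word_map_sim s x y : X x -> X y ->
  enorm (word_map f s x - word_map f s y) = word_prod c s * enorm (x - y).
Proof.
move=> Xx Xy; elim: s => [|a s ih].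
  by rewrite /word_map big_nil word_prod_nil mul1r.
by rewrite !word_map_cons f_sim ?ih ?word_prod_cons ?mulrA//; exact: word_map_mem.
Qed.

Lemma compact_word_map s : compact X -> compact (word_map f s @` X).
Proof.
move=> cX; apply: continuous_compact => //.
apply: (@lipschitz_within_continuous _ _ _ _ (word_prod c s)).
  by apply: word_prod_gt0 => a; case/andP: (c01 a).
by move=> x y Xx Xy; rewrite word_map_sim.
Qed.

Lemma word_prod_le1 s : word_prod c s <= 1.
Proof.
rewrite /word_prod; elim: s => [|a s ih]; first by rewrite big_nil.
have /andP[a0 a1] := c01 a; rewrite big_cons mulr_ile1 ?(ltW a0) ?(ltW a1)//.
by apply: prodr_ge0 => b _; have /andP[/ltW] := c01 b.
Qed.

(** Neither of two distinct cut words is a prefix of the other, so they branch at some letter. The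
    common prefix scales both sides equally, the hypothesis applies at the branching, and the rest
    of [s] only decreases the left-hand side, its ratio being at most 1. *)
Lemma cut_separated (h : letter -> R) n w eps s t (delta : R) x y :
  (forall i (j j' k : I i) x y, j != j' -> X x -> X y ->
    delta * c (Tagged I k) <=
      enorm (f (Tagged I j) x - f (Tagged I j') y)) -> 0 <= delta ->
  s \in cut h n w eps -> t \in cut h n w eps -> s != t -> X x -> X y ->
  delta * word_prod c s <= enorm (word_map f s x - word_map f t y).
Proof.
move=> sep delta0; elim: n w eps s t => [|n ih] w eps s t + + + Xx Xy.
  by rewrite /= !inE => /eqP -> /eqP ->; rewrite eqxx.
move=> /cutP[-> epsgt|m j s' [<-] epsle -> s'cut].
  move=> /cutP[->|m j' t' _ epsle]; first by rewrite eqxx.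
  by move: epsgt; rewrite /= ltNge epsle.
move=> /cutP[_ epsgt|m' j' t' [<-] _ -> t'cut].
  by move: epsgt; rewrite /= ltNge epsle.
have /andP[cj0 cj1] := c01 (Tagged I j).
rewrite !word_map_cons word_prod_cons => st.
have [jj'|jj'] := eqVneq j j'.
  rewrite -jj' in st t'cut *; rewrite f_sim; try exact: word_map_mem.
  rewrite mulrCA ler_pM2l//; apply: ih s'cut t'cut _ Xx Xy.
  by apply: contra st => /eqP ->.
have := sep _ j j' j _ _ jj' (word_map_mem fX s' Xx) (word_map_mem fX t' Xy).
apply: le_trans.
rewrite mulrA ler_piMr ?word_prod_le1//.
by rewrite mulr_ge0// ltW.
Qed.

End Similitudes.

(** * Masses of the cells *)

Section DependentSequences.
Context {N : nat} {I : 'I_N.+1 -> finType}.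
Implicit Types w : nat -> 'I_N.+1.

Definition dffun_cons n w (j : I (w 0%N))
    (s : {dffun forall k : 'I_n, I (shift w k)}) :
    {dffun forall k : 'I_n.+1, I (w k)} :=
  [ffun k : 'I_n.+1 => match k as k return I (w k) with
    | Ordinal 0 _ => j
    | Ordinal m.+1 mn => s (@Ordinal n m mn)
    end].

Lemma dffun_cons0 n w j (s : {dffun forall k : 'I_n, I (shift w k)}) :
  dffun_cons j s ord0 = j.
Proof. by rewrite ffunE. Qed.

Lemma dffun_consS n w j (s : {dffun forall k : 'I_n, I (shift w k)}) (k : 'I_n) :
  dffun_cons j s (lift ord0 k) = s k.
Proof.
rewrite ffunE /=; case: k => m mn /=.
by congr (s (Ordinal _)); exact: bool_irrelevance.
Qed.

Lemma sum_dffun_cons {V : nmodType} n w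
    (F : {dffun forall k : 'I_n.+1, I (w k)} -> V) :
  \sum_s F s = \sum_(j : I (w 0%N))
    \sum_(s : {dffun forall k : 'I_n, I (shift w k)}) F (dffun_cons j s).
Proof.
rewrite pair_bigA /= (reindex (fun js : _ * _ => dffun_cons js.1 js.2))//=.
apply: onW_bij.
exists (fun s : {dffun forall k : 'I_n.+1, I (w k)} =>
  (s ord0, [ffun k : 'I_n => s (lift ord0 k)] :
     {dffun forall k : 'I_n, I (shift w k)})) => [[j s]|s].
  rewrite dffun_cons0; congr pair; apply/ffunP => k.
  by rewrite ffunE; exact: dffun_consS.
apply/ffunP => -[[|m] mn]; rewrite ffunE /=.
  by congr (s (Ordinal _)); exact: bool_irrelevance.
rewrite ffunE /=.
by congr (s (Ordinal _)); exact: bool_irrelevance.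
Qed.

End DependentSequences.

(** [rss_approx] is a bare set function. The integral is computed by building, by induction on the
    sum, a genuine measure with the same underlying function. *)
Lemma integral_sum_dirac {d} {T : measurableType d} {R : realType} {J : Type}
    (s : seq J) (a : J -> R) (y : J -> T) (D : set T) (f : T -> \bar R) :
  measurable D -> (forall j, 0 <= a j) -> (forall x, D x -> (0 <= f x)%E) ->
  measurable_fun D f ->
  (\int[fun A => \sum_(j <- s) (a j)%:E * \d_(y j) A]_(x in D) f x =
   \sum_(j <- s) (a j)%:E * (\d_(y j) D * f (y j)))%E.
Proof.
move=> mD a0 f0 mf.
have [m [<- <-]//] : exists m : {measure set T -> \bar R},
   ((m : set T -> \bar R) = fun A => \sum_(j <- s) (a j)%:E * \d_(y j) A)%E /\
   (\int[m]_(x in D) f x = \sum_(j <- s) (a j)%:E * (\d_(y j) D * f (y j)))%E.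
elim: s => [|j s [m [mE mf_int]]].
  exists mzero; split; last by rewrite integral_measure_zero big_nil.
  by apply/funext => A; rewrite big_nil.
exists (measure_add (mscale (NngNum (a0 j)) \d_(y j)) m); split.
  apply/funext => A; rewrite big_cons; apply: etrans (measure_addE _ _ _) _.
  by rewrite mE.
rewrite ge0_integral_measure_add// big_cons mf_int.
by rewrite ge0_integral_mscale// integral_dirac.
Qed.

Section ApproximatingMeasures.
Context {R : realType} {d N : nat} {I : 'I_N.+1 -> finType}.
Local Notation letter := {i : 'I_N.+1 & I i}.
Variables (S : forall i : 'I_N.+1, I i -> 'rV[R]_d -> 'rV[R]_d).
Variables (p : forall i : 'I_N.+1, I i -> R) (X : set (borelRd R d)).
Variable x0 : 'rV[R]_d.
Hypothesis S_maps : forall i (j : I i) x, X x -> X (S j x).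
Hypothesis p0 : forall i (j : I i), 0 < p j.
Hypothesis Xx0 : X x0.

Definition letter_map (a : letter) : 'rV[R]_d -> 'rV[R]_d := S (tagged a).
Definition letter_prob (a : letter) : R := p (tagged a).

Lemma sum_path_mean n (w : nat -> 'I_N.+1) (phi : 'rV[R]_d -> R) :
  \sum_(s : {dffun forall k : 'I_n, I (w k)})
    (\prod_(k < n) p (s k)) * phi ((\big[comp/id]_(k < n) S (s k)) x0) =
  mean letter_prob letter_map x0 n w phi.
Proof.
elim: n w phi => [|n ih] w phi /=.
  under eq_bigr do rewrite !big_ord0 mul1r.
  rewrite sumr_const card_dep_ffun /image_mem.
  by rewrite (size0nil (size_enum_ord 0)).
apply: etrans (@sum_dffun_cons _ I _ n w _) _; apply: eq_bigr => j _.
rewrite -ih mulr_sumr.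
apply: eq_bigr => s _; rewrite !big_ord_recl dffun_cons0 mulrA.
congr (_ * _ * phi _).
  apply: (eq_bigr (fun k : 'I_n => p (s k))) => k _.
  by congr (p _); exact: dffun_consS.
rewrite /= /letter_map /=; congr (S _ _).
rewrite (eq_bigr (fun k : 'I_n => S (s k)))// => k _.
by congr (S _); exact: dffun_consS.
Qed.

Lemma integral_rss_approx n (w : nat -> 'I_N.+1) (phi : borelRd R d -> R) :
  measurable X -> measurable_fun X phi -> (forall x, X x -> 0 <= phi x) ->
  (\int[rss_approx S p X w (\d_(x0 : borelRd R d)) n]_(x in X) (phi x)%:E =
    (mean letter_prob letter_map x0 n w phi)%:E)%E.
Proof.
move=> mX mphi phi0.
pose y n (w : nat -> 'I_N.+1) (s : {dffun forall k : 'I_n, I (w k)}) : 'rV[R]_d :=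
  (\big[comp/id]_(k < n) S (s k)) x0.
have Xy s : X (y n w s).
  rewrite /y; elim: (index_enum _) => [|k r ih]; first by rewrite big_nil.
  by rewrite big_cons /=; exact: S_maps.
have -> : rss_approx S p X w (\d_(x0 : borelRd R d)) n =
    fun A => (\sum_(s : {dffun forall k : 'I_n, I (w k)})
      (\prod_(k < n) p (s k))%:E * \d_(y n w s : borelRd R d) A)%E.
  apply/funext => A; apply: eq_bigr => s _; congr (_ * _)%E.
  rewrite /dirac !indicE; congr ((nat_of_bool _)%:R%:E); apply/idP/idP.
    by rewrite !inE => -[].
  by rewrite !inE.
rewrite integral_sum_dirac//.
- rewrite -sum_path_mean -sumEFin; apply: eq_bigr => s _.
  by rewrite diracE mem_set// mul1e EFinM.
- by move=> s; apply: prodr_ge0 => k _; exact: ltW.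
- by apply/measurable_EFinP.
Qed.

Variables (m : probability (borelRd R d) R) (w : nat -> 'I_N.+1).
Hypothesis X_compact : compact (X : set 'rV[R]_d).
Hypothesis p1 : forall i, \sum_(j : I i) p j = 1.
Hypothesis m_rss : is_rss_measure S p X w m.

Let mX : measurable X. Proof. exact: compact_borel. Qed.

(* The Monge-Kantorovich distance bounds [a - \int phi] from above at all large
   steps. *)
Lemma rss_integral_ge (phi : 'rV[R]_d -> R) k a : lip1 X phi ->
  (forall x, X x -> 0 <= phi x) ->
  (forall n, (k <= n)%N -> mean letter_prob letter_map x0 n w phi = a) ->
  (a%:E <= \int[m]_(x in X) (phi x)%:E)%E.
Proof.
move=> phi1 phi0 phia; rewrite -sube_le0.
have x0X : (\d_(x0 : borelRd R d) : probability _ R) X = 1%E.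
  by rewrite /= diracE mem_set.
apply: cvge_ge (m_rss.2 _ x0X); exists k => // n kn /=.
apply: ereal_sup_ubound; exists phi => //.
by rewrite integral_rss_approx ?phia//; exact: lip1_borel.
Qed.

Section CutMasses.
Variables (h : {i : 'I_N.+1 & I i} -> R) (k : nat) (eps delta : R).
Let G : seq (seq {i : 'I_N.+1 & I i}) := cut h k w eps.
Let K (s : seq {i : 'I_N.+1 & I i}) : set (borelRd R d) :=
  word_map letter_map s @` X.
Hypothesis delta0 : 0 < delta.
Hypothesis K_compact : forall s, compact (K s : set 'rV[R]_d).
Hypothesis K_sep : forall s t x y, s \in G -> t \in G -> s != t ->
  K s x -> K t y -> delta <= enorm (x - y).

Let letter_prob1 i : \sum_(j : I i) letter_prob (Tagged I j) = 1.
Proof. exact: p1. Qed.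

Let letter_mapX a x : X x -> X (letter_map a x).
Proof. exact: S_maps. Qed.

Let mK s : measurable (K s). Proof. exact: compact_borel. Qed.

Let K0 s : K s !=set0.
Proof. by exists (word_map letter_map s x0); exists x0. Qed.

Let m_cell_le s0 : s0 \in G -> (m (K s0) <= (word_prod letter_prob s0)%:E)%E.
Proof.
move=> s0G; pose phi x := Num.min delta (infdist (K s0) x).
have phi1 : lip1 X phi by apply: min_lip1; exact: infdist_lip.
have phi0 x : 0 <= phi x by rewrite le_min (ltW delta0) infdist_ge0.
have meanE n : (k <= n)%N -> mean letter_prob letter_map x0 n w phi =
    delta * (1 - word_prod letter_prob s0).
  move=> kn; rewrite (mean_cut letter_prob1 letter_mapX Xx0 (h := h)
    (k := k) (eps := eps) (v := fun s => if s == s0 then 0 else delta))//.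
    rewrite -/G -(sum_word_prod_cut h k w eps letter_prob1) -/G.
    rewrite !(big_rem _ s0G)/= eqxx mulr0 add0r addrAC subrr add0r mulr_sumr.
    rewrite big_seq [RHS]big_seq; apply: eq_bigr => s.
    rewrite mem_rem_uniq ?uniq_cut// inE => /andP[/negbTE -> _].
    by rewrite mulrC.
  move=> s x sG Xx; case: eqVneq => [->|ss0].
    rewrite /phi infdist_mem; last by exists x.
    by apply/min_idPr; exact: ltW.
  apply/min_idPl; apply: infdist_ge => // y Ky.
  by apply: K_sep sG s0G ss0 _ Ky; exists x.
have := rss_integral_ge phi1 (fun x _ => phi0 x) meanE.
have : (\int[m]_(x in X) (phi x)%:E <=
   \int[m]_(x in X) (delta%:E * (\1_(~` K s0) x)%:E))%E.
  apply: ge0_le_integral => //.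
  - by move=> x _; rewrite lee_fin.
  - by apply/measurable_EFinP; exact: lip1_borel.
  - apply: emeasurable_funM; first exact: measurable_cst.
    by apply/measurable_EFinP; apply: measurable_indic; exact: measurableC.
  - move=> x _; rewrite -EFinM lee_fin indicE.
    have [xK|xK] := pselect (K s0 x).
      by rewrite /phi infdist_mem// memNset ?mulr0 ?ge_min ?lexx ?orbT//; apply.
    by rewrite mem_set// mulr1 /phi ge_min lexx.
rewrite ge0_integralZl//; last 2 first.
- by apply/measurable_EFinP; apply: measurable_indic; exact: measurableC.
- by rewrite lee_fin ltW.
rewrite integral_indic//; last exact: measurableC.
move=> h1 h2; have := le_trans h2 h1.
have : (m (~` K s0 `&` X) <= 1 - m (K s0))%E.
  rewrite -probability_setC//; apply: le_measure; rewrite ?inE//.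
    by apply: measurableI => //; exact: measurableC.
  exact: measurableC.
move=> h3 h4; have : ((delta * (1 - word_prod letter_prob s0))%:E <=
    delta%:E * (1 - m (K s0)))%E.
  by apply: le_trans h4 _; rewrite lee_pmul2l.
rewrite EFinM lee_pmul2l// -(fineK (fin_num_measure m _ (mK s0))).
by rewrite -EFinB !lee_fin lerD2l lerN2.
Qed.

(** Only lower bounds on integrals are at hand, hence the test function [psi = delta - phi]: it
    equals [delta] on the union [U], so its integral is at least [delta], which forces the integral
    of [phi] to vanish. Almost every point of [X] is then at distance 0 from the compact set [U]. *)
Lemma m_cells : m (\big[setU/set0]_(s <- G) K s) = 1%E.
Proof.
set U := \big[setU/set0]_(s <- G) K s.
have mU : measurable U by apply: bigsetU_measurable.
have cU : compact (U : set 'rV[R]_d) by apply: bigsetU_compact.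
have memU x : U x <-> exists2 s, s \in G & K s x.
  rewrite /U -bigcup_seq; split=> [[s sG Kx]|[s sG Kx]]; by exists s.
have U0 : U !=set0.
  have [s sG] : exists s, s \in G.
    have := sum_word_prod_cut h k w eps letter_prob1; rewrite -/G.
    case: (G) => [|s l _]; last by exists s; rewrite mem_head.
    by rewrite big_nil => /eqP; rewrite eq_sym oner_eq0.
  by have [x Kx] := K0 s; exists x; apply/memU; exists s.
pose phi x := Num.min delta (infdist U x).
have phi1 : lip1 X phi by apply: min_lip1; exact: infdist_lip.
have phi0 x : 0 <= phi x by rewrite le_min (ltW delta0) infdist_ge0.
have mphi : measurable_fun X (EFin \o phi).
  by apply/measurable_EFinP; exact: lip1_borel.
pose psi x := delta - phi x.
have psi1 : lip1 X psi.
  move=> x y Xx Xy; rewrite /psi opprB addrC addrA subrK distrC.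
  exact: phi1.
have psi0 x : 0 <= psi x by rewrite subr_ge0 ge_min lexx.
have mpsi : measurable_fun X (EFin \o psi).
  by apply/measurable_EFinP; exact: lip1_borel.
have meanE n : (k <= n)%N -> mean letter_prob letter_map x0 n w psi = delta.
  move=> kn; rewrite (mean_cut letter_prob1 letter_mapX Xx0 (h := h)
    (k := k) (eps := eps) (v := fun=> delta))//.
    by rewrite -mulr_suml sum_word_prod_cut// mul1r.
  move=> s x sG Xx; rewrite /psi /phi infdist_mem.
    by rewrite (min_idPr _) ?subr0// ltW.
  by apply/memU; exists s => //; exists x.
have psi_ge := rss_integral_ge psi1 (fun x _ => psi0 x) meanE.
have int_phi0 : (\int[m]_(x in X) (phi x)%:E = 0)%E.
  have : (\int[m]_(x in X) (phi x)%:E + \int[m]_(x in X) (psi x)%:E =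
      delta%:E)%E.
    rewrite -ge0_integralD//; [|by move=> x _; rewrite lee_fin..].
    under eq_integral do rewrite -EFinD /psi addrC subrK.
    rewrite integral_cst//; apply: etrans (congr1 (mule delta%:E) m_rss.1) _.
    by rewrite mule1.
  have : (0 <= \int[m]_(x in X) (phi x)%:E)%E.
    by apply: integral_ge0 => x _; rewrite lee_fin.
  case: (\int[m]_(x in X) (phi x)%:E)%E => [u||] //; last first.
    by move: psi_ge; case: (\int[m]_(x in X) (psi x)%:E)%E.
  move: psi_ge; case: (\int[m]_(x in X) (psi x)%:E)%E => // v.
  rewrite !lee_fin => dv u0 [] uv; congr EFin; lra.
have : ae_eq m X (EFin \o phi) (cst 0%E).
  apply/ae_eq_integral_abs => //; rewrite -int_phi0.
  by apply: eq_integral => x _ /=; rewrite ger0_norm.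
move=> [Z [mZ Z0 XZ]].
have XUZ : X `\` U `<=` Z.
  move=> x [Xx nUx]; apply: XZ => /= /(_ Xx) [] phix0.
  apply: nUx; apply: (infdist_eq0 cU U0).
  move: phix0; rewrite /phi /Num.min; case: ltP => // _ d0.
  by have := delta0; rewrite d0 ltxx.
have XU : m (X `\` U) = 0%E.
  by apply: (subset_measure0 _ _ XUZ) => //; exact: measurableD.
apply/eqP; rewrite eq_le probability_le1//= -m_rss.1.
apply: (@le_trans _ _ (m (U `|` X `\` U))).
  apply: le_measure; rewrite ?inE//.
    by apply: measurableU => //; exact: measurableD.
  by move=> x Xx; have [Ux|nUx] := pselect (U x); [left|right].
rewrite -[leRHS]adde0 -XU; apply: measureU2 => //; exact: measurableD.
Qed.

(** The upper bounds [m_cell_le] sum to 1 and the cells carry total mass 1, so none of them can be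
    strict. *)
Lemma m_cell s0 : s0 \in G -> m (K s0) = (word_prod letter_prob s0)%:E.
Proof.
move=> s0G; apply/eqP; rewrite eq_le m_cell_le//=.
have mE s : m (K s) = (fine (m (K s)))%:E.
  by rewrite fineK//; exact: fin_num_measure.
have : (1 <= \sum_(s <- G) m (K s))%E.
  by rewrite -m_cells; exact: measure_bigsetU_le.
rewrite (eq_bigr (fun s => (fine (m (K s)))%:E)) => [|s _]; last exact: mE.
rewrite sumEFin lee_fin -(sum_word_prod_cut h k w eps letter_prob1) -/G.
rewrite !(big_rem _ s0G)/= mE lee_fin => le.
have : \sum_(s <- rem s0 G) fine (m (K s)) <=
    \sum_(s <- rem s0 G) word_prod letter_prob s.
  rewrite big_seq [leRHS]big_seq; apply: ler_sum => s /mem_rem sG.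
  by rewrite -lee_fin -mE; exact: m_cell_le.
lra.
Qed.

End CutMasses.

End ApproximatingMeasures.

(** * Quantization error *)

Section SeparatedCells.
Context {R : realType} {d : nat} {T : choiceType}.
Variables (mu : probability (borelRd R d) R) (r : R) (G : seq T).
Variables (K : T -> set (borelRd R d)) (q : T -> R).
Hypothesis r0 : 0 < r.
Hypothesis mK : forall s, measurable (K s).
Hypothesis muK : forall s, s \in G -> mu (K s) = (q s)%:E.

Lemma point_dist_infdist (alpha : set 'rV[R]_d) (x : 'rV[R]_d) :
  alpha !=set0 -> point_dist x alpha = (infdist alpha x)%:E.
Proof.
move=> [a aa]; rewrite /point_dist /infdist -ereal_inf_EFin.
- by rewrite image_comp.
- by exists 0 => _ [b _ <-]; exact: enorm_ge0.
- by exists (enorm (x - a)); exists a.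
Qed.

Lemma measurable_dist_pow (alpha : set 'rV[R]_d) :
  measurable_fun [set: borelRd R d]
    (fun x : borelRd R d => poweR (point_dist x alpha) r).
Proof.
(* For an empty codebook the distance is the constant [+oo]. *)
have [->|/set0P a0] := eqVneq alpha set0.
  under eq_fun do rewrite /point_dist image_set0 ereal_inf0.
  exact: measurable_cst.
under eq_fun do rewrite point_dist_infdist// poweR_EFin.
apply/measurable_EFinP.
apply: (@measurableT_comp _ _ _ _ _ _ (@powR R ^~ r)).
  exact: measurable_powR.
by apply: lip1_borel => //; exact: infdist_lip.
Qed.

Lemma integral_cell_sum (l : seq T) (a : T -> R) : {subset l <= G} ->
  (forall s, 0 <= a s) ->
  (\int[mu]_x (\sum_(s <- l) (a s)%:E * (\1_(K s) x)%:E) =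
    (\sum_(s <- l) a s * q s)%:E)%E.
Proof.
move=> lG a0; rewrite ge0_integral_sum//; last 2 first.
- move=> s; apply: emeasurable_funM => //.
  by apply/measurable_EFinP; exact: measurable_indic.
- by move=> s x _; rewrite -EFinM lee_fin mulr_ge0.
rewrite -sumEFin big_seq [RHS]big_seq; apply: eq_bigr => s /lG sG.
rewrite ge0_integralZl//; last 2 first.
- by apply/measurable_EFinP; exact: measurable_indic.
- by rewrite lee_fin.
by rewrite integral_indic// setIT EFinM; congr (_ * _)%E; exact: muK.
Qed.

Lemma measurable_cell_sum (l : seq T) (a : T -> R) :
  measurable_fun [set: borelRd R d]
    (fun x => \sum_(s <- l) (a s)%:E * (\1_(K s) x)%:E)%E.
Proof.
apply: emeasurable_sum => s; apply: emeasurable_funM => //.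
by apply/measurable_EFinP; exact: measurable_indic.
Qed.

(** The codebook takes the one point [y s] for each cell; the pointwise bound holds on the union of
    the cells, which has full mass. *)
Lemma quant_error_le (m : nat) (y : T -> 'rV[R]_d) (v : T -> R) :
  (0 < size G <= m)%N -> mu (\big[setU/set0]_(s <- G) K s) = 1%E ->
  (forall s x, s \in G -> K s x -> enorm (x - y s) <= v s) ->
  (quant_error r mu m <= (\sum_(s <- G) v s `^ r * q s)%:E)%E.
Proof.
move=> /andP[G0 Gm] muU yv.
have [s0 s0G] : exists s0, s0 \in G.
  by case: (G) G0 => // s l _; exists s; rewrite mem_head.
pose alpha := (fun i => y (nth s0 G i)) @` `I_(size G).
have alphay s : s \in G -> alpha (y s).
  by move=> sG; exists (index s G); rewrite ?nth_index//= index_mem.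
apply: (@le_trans _ _ (\int[mu]_x poweR (point_dist x alpha) r)%E).
  apply: ereal_inf_lbound; exists alpha => //=.
  by apply: card_le_trans (card_image_le _ _) _; rewrite card_le_II.
rewrite -integral_cell_sum//; last by move=> s; exact: powR_ge0.
apply: ae_ge0_le_integral => //.
- by move=> x _; exact: poweR_ge0.
- exact: measurable_dist_pow.
- move=> x _; apply: sume_ge0 => s _.
  by rewrite -EFinM lee_fin mulr_ge0 ?powR_ge0.
- exact: measurable_cell_sum.
exists (~` \big[setU/set0]_(s <- G) K s); split.
- by apply: measurableC; exact: bigsetU_measurable.
- by rewrite [LHS]probability_setC ?muU ?subee//; exact: bigsetU_measurable.
apply: subsetC => x; rewrite -bigcup_seq => -[s sG Kx] _.
rewrite point_dist_infdist ?poweR_EFin; last by exists (y s); exact: alphay.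
have Gx : ((v s `^ r)%:E <= \sum_(s <- G) (v s `^ r)%:E * (\1_(K s) x)%:E)%E.
  rewrite (big_rem _ sG)/= indicE mem_set// mule1 leeDl//.
  apply: sume_ge0 => t _.
  by rewrite -EFinM lee_fin mulr_ge0 ?powR_ge0.
apply: le_trans Gx; rewrite lee_fin.
have id0 : 0 <= infdist alpha x.
  by apply: infdist_ge0; exists (y s); exact: alphay.
have idv : infdist alpha x <= v s.
  exact: le_trans (infdist_le _ (alphay _ sG)) (yv _ _ sG Kx).
by apply: ge0_ler_powR => //; rewrite ?nnegrE ?(ltW r0)// (le_trans id0).
Qed.

(** A codebook point within [u s] of [K s] and within [u t] of [K t] would violate the separation,
    so at most [m] cells are hit. Each of the others contributes at least [eta]. *)
Lemma quant_error_ge (m : nat) (u : T -> R) (eta : R) :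
  uniq G -> (forall s, 0 < u s) ->
  (forall s t x y, s \in G -> t \in G -> s != t -> K s x -> K t y ->
    2 * u s <= enorm (x - y)) -> 0 <= eta ->
  (forall s, s \in G -> eta <= u s `^ r * q s) ->
  (((size G - m)%N%:R * eta)%:E <= quant_error r mu m)%E.
Proof.
move=> uG u0 sep eta0 etaG; apply: le_ereal_inf_tmp => _ [alpha /= alpham <-].
pose hit s := exists a, alpha a /\ exists2 x, K s x & enorm (x - a) < u s.
pose Gm := [seq s <- G | `[< hit s >]].
pose Gn := [seq s <- G | ~~ `[< hit s >]].
have sGm : (size Gm <= m)%N.
  have fa : finite_set alpha by apply/finite_set_leP; exists m.
  (* Choosing a nearby codebook point for each hit cell gives an injection into [alpha]; the value 0
     on unhit cells is a dummy. *)
  pose a s := if pselect (hit s) is left h then sval (cid h) else 0.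
  have aP s : hit s -> alpha (a s) /\ exists2 x, K s x & enorm (x - a s) < u s.
    by move=> hs; rewrite /a; case: pselect => // h; exact: svalP (cid h).
  apply: leq_trans _ (geq_card_fset_set alpham).
  rewrite -(size_map a); apply: uniq_leq_size.
    rewrite map_inj_in_uniq ?filter_uniq// => s t.
    rewrite !mem_filter => /andP[/asboolP hs sG] /andP[/asboolP ht tG] ast.
    apply/eqP; apply: contrapT => /negP st.
    have [_ [x Kx xa]] := aP _ hs; have [_ [y Ky ya]] := aP _ ht.
    have h1 := sep _ _ _ _ sG tG st Kx Ky.
    have h2 : 2 * u t <= enorm (x - y).
      by rewrite enormC; apply: sep Ky Kx; rewrite // eq_sym.
    have := enorm_dist_triangle x (a s) y; rewrite [enorm (a s - y)]enormC ast.
    by rewrite ast in xa; lra.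
  move=> _ /mapP[s + ->]; rewrite mem_filter => /andP[/asboolP hs _].
  by rewrite in_fset_set// mem_set//; exact: (aP _ hs).1.
have GnG : {subset Gn <= G} by move=> s; rewrite mem_filter => /andP[].
apply: (@le_trans _ _ (\sum_(s <- Gn) u s `^ r * q s)%:E).
  rewrite lee_fin; apply: (@le_trans _ _ (\sum_(s <- Gn) eta)).
    rewrite big_const_seq count_predT iter_addr_0 -[leRHS]mulr_natl.
    rewrite ler_wpM2r// ler_nat leq_subLR.
    rewrite -(count_predC (fun s => `[< hit s >]) G) -!size_filter.
    by rewrite leq_add2r.
  by rewrite big_seq [leRHS]big_seq; apply: ler_sum => s /GnG; exact: etaG.
rewrite -integral_cell_sum//; last by move=> s; exact: powR_ge0.
apply: ge0_le_integral => //.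
- move=> x _; apply: sume_ge0 => s _.
  by rewrite -EFinM lee_fin mulr_ge0 ?powR_ge0.
- exact: measurable_cell_sum.
- exact: measurable_dist_pow.
(* Separated cells are disjoint, so at most one term of the sum is nonzero at [x]. *)
move=> x _; have [[s [sGn Kx]]|no] := pselect (exists s, s \in Gn /\ K s x).
  rewrite (big_rem _ sGn)/= indicE mem_set// mule1 big_seq big1 ?adde0.
    rewrite -poweR_EFin; apply: gt0_ler_poweR; first exact: ltW.
    - by rewrite in_itv/= leey andbT lee_fin ltW.
    - rewrite in_itv/= leey andbT; apply: le_ereal_inf_tmp => _ [a _ <-].
      by rewrite lee_fin enorm_ge0.
    apply: le_ereal_inf_tmp => _ [a aa <-]; rewrite lee_fin leNgt.
    move: sGn; rewrite mem_filter => /andP[/asboolP hs _].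
    by apply/negP => xa; apply: hs; exists a; split => //; exists x.
  move=> t; rewrite mem_rem_uniq ?filter_uniq// inE => /andP[ts tGn].
  rewrite indicE memNset ?mule0// => Ktx.
  have := sep _ _ _ _ (GnG _ sGn) (GnG _ tGn) _ Kx Ktx.
  rewrite eq_sym => /(_ ts); rewrite subrr enorm0; have := u0 s; lra.
rewrite big_seq big1 ?poweR_ge0// => s sGn.
by rewrite indicE memNset ?mule0// => Kx; apply: no; exists s.
Qed.

End SeparatedCells.

(** * Diameters and distances between sets *)

Section Diameter.
Context {R : realType} {d : nat}.
Implicit Types A B : set 'rV[R]_d.

(** A [sup] is meaningful only for a bounded set; the bound comes from the continuous distance to
    [x] on the compact set [A]. *)
Lemma enorm_le_diam A x y : compact A -> A x -> A y -> enorm (x - y) <= diam A.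
Proof.
move=> cA Ax Ay; apply: ub_le_sup; last by exists (x, y).
have : compact (infdist [set x] @` A).
  apply: continuous_compact => //; apply: lip1_within_continuous.
  by apply: infdist_lip; exists x.
move=> /compact_bounded[M [_ AM]].
have {}AM z : A z -> enorm (z - x) <= M + 1.
  move=> Az; apply: (@le_trans _ _ (infdist [set x] z)).
    by apply: infdist_ge => [|_ ->//]; exists x.
  by apply: le_trans (ler_norm _) _; apply: AM; [rewrite ltrDl|exists z].
exists (M + 1 + (M + 1)) => _ [[z z'] [/= Az Az'] <-].
apply: le_trans (enorm_dist_triangle z x z') _.
by rewrite lerD ?AM// enormC AM.
Qed.

Lemma set_dist_le A B x y : A x -> B y -> set_dist A B <= enorm (x - y).
Proof.
move=> Ax By; apply: ge_inf; last by exists (x, y).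
by exists 0 => _ [z _ <-]; exact: enorm_ge0.
Qed.

Lemma diam_similitude A (f : 'rV[R]_d -> 'rV[R]_d) (k : R) :
  0 < k -> compact A -> A !=set0 ->
  (forall x y, A x -> A y -> enorm (f x - f y) = k * enorm (x - y)) ->
  k * diam A <= diam (f @` A).
Proof.
move=> k0 cA [a Aa] fk; rewrite mulrC -ler_pdivlMr//.
apply: ge_sup; first by exists (enorm (a - a)); exists (a, a).
move=> _ [[x y] [/= Ax Ay] <-]; rewrite ler_pdivlMr// mulrC -fk//.
apply: enorm_le_diam; [|by exists x|by exists y].
apply: continuous_compact => //; apply: (lipschitz_within_continuous k0).
by move=> u v Au Av; rewrite fk.
Qed.

End Diameter.

Lemma uniform_pos_lb {R : realType} {T : eqType} (l : seq T) (f : T -> R) :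
  (forall s, s \in l -> 0 < f s) ->
  exists2 e, 0 < e & forall s, s \in l -> e <= f s.
Proof.
elim: l => [_|s l ih fl]; first by exists 1.
have [t tl|e e0 el] := ih; first by rewrite fl// inE tl orbT.
exists (Num.min e (f s)); first by rewrite lt_min e0 fl// mem_head.
move=> t; rewrite inE => /predU1P[->|/el]; first by rewrite ge_min lexx orbT.
by move=> et; rewrite ge_min et.
Qed.

Lemma sumr_const_seq {R : pzRingType} {T : Type} (l : seq T) (x : R) :
  \sum_(i <- l) x = (size l)%:R * x.
Proof. by rewrite big_const_seq count_predT iter_addr_0 mulr_natl. Qed.

(** * Counting the cells of a cut *)

Section CutSize.
Context {R : realType} {N : nat} {I : 'I_N.+1 -> finType}.
Local Notation letter := {i : 'I_N.+1 & I i}.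
Variables (h : letter -> R) (s hmin hmax : R) (w : nat -> 'I_N.+1).
Hypothesis hmin0 : 0 < hmin.
Hypothesis hmin_le : forall a, hmin <= h a.
Hypothesis hmax1 : hmax < 1.
Hypothesis hmax_ge : forall a, h a <= hmax.
Hypothesis s0 : 0 < s.
Hypothesis I0 : forall i, (0 < #|I i|)%N.

Let t (i : 'I_N.+1) : R := \sum_(j : I i) h (Tagged I j) `^ s.

Let h0 a : 0 < h a. Proof. exact: lt_le_trans (hmin_le a). Qed.

Let t0 i : 0 < t i.
Proof.
have /card_gt0P[j _] := I0 i; rewrite /t (bigD1 j)//= ltr_pwDl ?powR_gt0//.
by apply: sumr_ge0 => k _; exact: powR_ge0.
Qed.

Let q (a : letter) : R := h a `^ s / t (tag a).

Let q1 i : \sum_(j : I i) q (Tagged I j) = 1.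
Proof. by rewrite /q /= -mulr_suml -/(t i) divff ?gt_eqF ?t0. Qed.

Let word_prod_q l : word_prod q l = word_prod h l `^ s / word_prod (t \o tag) l.
Proof.
elim: l => [|a l ih]; first by rewrite !word_prod_nil powR1 divr1.
rewrite !word_prod_cons ih powRM ?(ltW (h0 _)) ?ltW ?word_prod_gt0//.
by rewrite /q /= invfM mulrACA.
Qed.

(** The weights [word_prod q] sum to 1 over the cut. Each is a power [s] of a number between
    [hmin * expR (- L)] and [expR (- L)], divided by a product of sums [t] controlled by the
    assumption; hence two-sided bounds on the number of terms. *)
Lemma cut_size_ln (C eta : R) n (L : R) :
  0 <= L -> 0 <= eta ->
  (forall k, `|\sum_(i < k) ln (t (w i))| <= C + eta * k%:R) ->
  hmax ^+ n <= expR (- L) ->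
  let M := size (cut h n w (expR (- L))) in
  [/\ (0 < M)%N, s * L - (C + eta * n%:R) <= ln M%:R
    & ln M%:R <= s * L + (C + eta * n%:R - s * ln hmin)].
Proof.
move=> L0 eta0 sumln hn M; set G := cut h n w (expR (- L)) in M *.
set B := C + eta * n%:R.
have eps1 : expR (- L) <= 1 by rewrite -expR0 ler_expR oppr_le0.
have hG l : l \in G -> ln hmin - L <= ln (word_prod h l) <= - L.
  move=> lG; have /card_gt0P[j _] := I0 ord0.
  have hmin1 : hmin <= 1.
    apply: le_trans (ltW hmax1); exact: le_trans (hmax_ge (Tagged I j)).
  rewrite -(expRK (- L)) -lnM ?posrE ?expR_gt0//.
  rewrite !ler_ln ?posrE ?mulr_gt0 ?expR_gt0 ?word_prod_gt0//.
  rewrite (cut_weight_ge hmin0 hmin_le _ lG) ?mulr_ile1 ?(ltW hmin0) ?expR_ge0//=.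
  by apply: cut_weight_le hn lG => a; rewrite h0 hmax_ge.
have qG l : l \in G ->
    expR (s * (ln hmin - L) - B) <= word_prod q l <= expR (s * (- L) + B).
  move=> lG; have /andP[h1 h2] := hG _ lG.
  have -> : word_prod q l =
      expR (s * ln (word_prod h l) - \sum_(k < size l) ln (t (w k))).
    rewrite word_prod_q expRB [s * _]mulrC expRM lnK ?posrE ?word_prod_gt0//.
    rewrite (cut_tags _ lG) expR_sum; congr (_ / _); apply: eq_bigr => k _.
    by rewrite lnK// posrE.
  have := sumln (size l); rewrite ler_norml => /andP[h3 h4].
  have h5 : C + eta * (size l)%:R <= B.
    by rewrite lerD2l ler_wpM2l// ler_nat (size_cut lG).
  rewrite !ler_expR; move: h1 h2; rewrite -(ler_pM2l s0) -(ler_pM2l s0 (ln _)).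
  by move=> h1 h2; apply/andP; split; lra.
have sum1 : \sum_(l <- G) word_prod q l = 1 by exact: sum_word_prod_cut.
have ub : 1 <= M%:R * expR (s * (- L) + B).
  rewrite -[leLHS]sum1 -sumr_const_seq big_seq [leRHS]big_seq.
  by apply: ler_sum => l /qG/andP[].
have lb : M%:R * expR (s * (ln hmin - L) - B) <= 1.
  rewrite -[leRHS]sum1 -sumr_const_seq big_seq [leRHS]big_seq.
  by apply: ler_sum => l /qG/andP[].
have M0 : (0 < M)%N.
  by move: ub; case: (M) => //; rewrite mul0r ler10.
have MR0 : 0 < M%:R :> R by rewrite ltr0n.
split=> //.
- move: ub; rewrite -ler_ln ?posrE ?mulr_gt0 ?expR_gt0//.
  by rewrite ln1 lnM ?posrE ?expR_gt0// expRK; lra.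
- move: lb; rewrite -ler_ln ?posrE ?mulr_gt0 ?expR_gt0//.
  by rewrite ln1 lnM ?posrE ?expR_gt0// expRK; lra.
Qed.

End CutSize.

(** * Quantization error at one scale *)

Section QuantizationBounds.
Context {R : realType} {d N : nat} {I : 'I_N.+1 -> finType}.
Local Notation letter := {i : 'I_N.+1 & I i}.
Variable X : set 'rV[R]_d.
Variable S : forall i : 'I_N.+1, I i -> 'rV[R]_d -> 'rV[R]_d.
Variables (c p : forall i : 'I_N.+1, I i -> R) (r s : R).
Hypothesis X_nonempty : X !=set0.
Hypothesis X_compact : compact X.
Hypothesis X_diam : 0 < diam X.
Hypothesis I_card : forall i, (1 < #|I i|)%N.
Hypothesis S_maps : forall i (j : I i) x, X x -> X (S j x).
Hypothesis S_sim : forall i (j : I i) x y, X x -> X y ->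
  enorm (S j x - S j y) = c j * enorm (x - y).
Hypothesis c_bound : forall i (j : I i), 0 < c j < 1.
Hypothesis p_gt0 : forall i (j : I i), 0 < p j.
Hypothesis p_sum : forall i, \sum_(j : I i) p j = 1.
Hypothesis r_gt0 : 0 < r.
Hypothesis s_gt0 : 0 < s.
Hypothesis S_uessc : uessc S X.

Let f := letter_map S.
Let q := letter_prob p.
Let cc (a : letter) : R := c (tagged a).
Let h (a : letter) : R := q a * cc a `^ r.

Let q_lt1 a : q a < 1.
Proof.
case: a => i j; rewrite /q /letter_prob /= -(p_sum i) (bigD1 j)//= ltrDl.
have : (0 < #|[pred k | k != j]|)%N.
  by rewrite cardC1; case: #|I i| (I_card i) => [|[]].
move=> /card_gt0P[k kj]; rewrite (bigD1 k)//= ltr_pwDl//.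
by apply: sumr_ge0 => l _; exact: ltW.
Qed.

Let q_gt0 a : 0 < q a. Proof. exact: p_gt0. Qed.

Let cc_bound a : 0 < cc a < 1. Proof. exact: c_bound. Qed.

Let cc_gt0 a : 0 < cc a. Proof. by have /andP[] := cc_bound a. Qed.

Let h_gt0 a : 0 < h a. Proof. by rewrite mulr_gt0 ?powR_gt0. Qed.

Let h_lt1 a : h a < 1.
Proof.
have /andP[c0 c1] := cc_bound a.
apply: (@le_lt_trans _ _ (q a)) => //.
rewrite ler_piMr ?(ltW (q_gt0 a))//.
have : cc a `^ r <= 1 `^ r by apply: ge0_ler_powR; rewrite ?nnegrE ?ltW.
by rewrite powR1.
Qed.

Let word_prod_h l : word_prod h l = word_prod q l * word_prod cc l `^ r.
Proof.
elim: l => [|a l ih]; first by rewrite !word_prod_nil powR1 mulr1.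
rewrite !word_prod_cons ih powRM ?(ltW (cc_gt0 _)) ?ltW ?word_prod_gt0//.
by rewrite /h mulrACA.
Qed.

Let f_maps a x : X x -> X (f a x). Proof. exact: S_maps. Qed.

Let f_sim a x y : X x -> X y -> enorm (f a x - f a y) = cc a * enorm (x - y).
Proof. exact: S_sim. Qed.

(** UESSC bounds gaps below by the largest diameter of a first-level cell, and the cell of index [k]
    has diameter at least [c k * diam X]; so [delta = beta * diam X] works for every [k]. *)
Let f_sep : exists2 delta, 0 < delta &
  forall i (j j' k : I i) x y, j != j' -> X x -> X y ->
    delta * cc (Tagged I k) <= enorm (f (Tagged I j) x - f (Tagged I j') y).
Proof.
have [beta beta0 sep] := S_uessc.
exists (beta * diam X) => [|i j j' k x y jj' Xx Xy]; first exact: mulr_gt0.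
have := set_dist_le (imageP (S j) Xx) (imageP (S j') Xy).
apply: le_trans; apply: le_trans (sep _ _ _ jj').
rewrite -mulrA ler_pM2l// mulrC.
apply: (@le_trans _ _ (diam (S k @` X))).
  apply: diam_similitude => // u v Xu Xv; exact: S_sim.
exact: (le_bigmax _ (fun k => diam (S k @` X))).
Qed.

Let h_bounds : exists hmin hmax : R, [/\ 0 < hmin, hmax < 1,
  forall a, hmin <= h a & forall a, h a <= hmax].
Proof.
have h1 a : 0 < 1 - h a by rewrite subr_gt0.
have [hmin hmin0 hminP] := uniform_pos_lb (l := enum (@predT letter))
  (fun a _ => h_gt0 a).
have [e e0 eP] := uniform_pos_lb (l := enum (@predT letter)) (fun a _ => h1 a).
exists hmin, (1 - e); split=> // [|a|a].
- lra.
- by apply: hminP; rewrite mem_enum.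
- by have := eP a; rewrite mem_enum => /(_ isT); lra.
Qed.

(** [M] is the number of cells at scale [expR (- L)]. Mass times the [r]-th power of the ratio is
    the weight [h], comparable to [expR (- L)] on every cell, so all cells contribute alike. *)
Lemma quant_error_bounds : exists C1 C2 : R, [/\ 0 < C1, 0 < C2 &
  forall w : nat -> 'I_N.+1,
  (forall eta, 0 < eta -> exists C, forall n,
    `|\sum_(k < n) ln (\sum_(j : I (w k)) (p j * c j `^ r) `^ s)|
      <= C + eta * n%:R) ->
  forall mu : probability (borelRd R d) R, is_rss_measure S p X w mu ->
  forall eta, 0 < eta -> exists C, forall L, 0 <= L -> exists M : nat,
  [/\ (0 < M)%N, `|ln M%:R - s * L| <= C + eta * L,
    forall m, (M <= m)%N ->
      (quant_error r mu m <= (C1 * M%:R * expR (- L))%:E)%E &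
    forall m, (2 * m <= M)%N ->
      ((C2 * M%:R * expR (- L))%:E <= quant_error r mu m)%E]].
Proof.
have [hmin [hmax [hmin0 hmax1 hminP hmaxP]]] := h_bounds.
have [delta delta0 sep] := f_sep.
have [x0 Xx0] := X_nonempty.
have hmax0 : 0 < hmax.
  have /card_gt0P[j _] := ltnW (I_card ord0).
  exact: lt_le_trans (hmaxP (Tagged I j)).
pose lam := - ln hmax.
have lam0 : 0 < lam by rewrite /lam oppr_gt0 ln_lt0// hmax0.
(* In the second constant, [delta / 2] is half the relative gap, [hmin] the overshoot of the
   stopping rule, and the last half the proportion of cells that stay far from the codebook. *)
exists (diam X `^ r), ((delta / 2) `^ r * hmin / 2); split.
- exact: powR_gt0.
- by rewrite !mulr_gt0 ?powR_gt0 ?divr_gt0// invr_gt0.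
move=> w good mu mu_rss eta eta0.
(* The factor [lam] compensates for the cut length: [n <= L / lam + 1] turns [eta * lam * n] into at
   most [eta * L + eta * lam]. *)
have [C sumC] := good (eta * lam) (mulr_gt0 eta0 lam0).
exists (C + eta * lam + s * `|ln hmin|) => L L0.
(* Long enough for [hmax ^+ n <= expR (- L)], so that the cut is not truncated. *)
pose n := (Num.trunc (L / lam)).+1.
have nL : n%:R <= L / lam + 1.
  by rewrite -natr1 lerD2r truncn_le divr_ge0// ltW.
have hn : hmax ^+ n <= expR (- L).
  rewrite -(@lnK _ hmax) ?posrE// -expRM_natl ler_expR.
  rewrite -[ln hmax]opprK -/lam mulrN lerN2 -ler_pdivrMr//.
  by rewrite ltW// truncnS_gt.
have C0 : 0 <= C.
  by apply: le_trans (le_trans (normr_ge0 _) (sumC 0%N)) _; rewrite mulr0 addr0.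
have I0 i : (0 < #|I i|)%N by exact: ltnW (I_card i).
have := cut_size_ln hmin0 hminP hmax1 hmaxP s_gt0 I0 L0
  (ltW (mulr_gt0 eta0 lam0)) sumC hn.
set G := cut h n w (expR (- L)) => -[G0 lnG1 lnG2].
have hG l : l \in G -> hmin * expR (- L) <= word_prod h l <= expR (- L).
  move=> lG; rewrite (cut_weight_ge hmin0 hminP _ lG) ?mulr_ile1
    ?(ltW hmin0) ?expR_ge0//=.
  - by apply: cut_weight_le hn lG => a; rewrite h_gt0 hmaxP.
  - have /card_gt0P[j _] := I0 ord0.
    by apply: le_trans (ltW hmax1); exact: le_trans (hmaxP (Tagged I j)).
  - by rewrite -expR0 ler_expR oppr_le0.
pose K (l : seq letter) : set (borelRd R d) := word_map f l @` X.
have K_compact l : compact (K l : set 'rV[R]_d).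
  exact: (compact_word_map f_maps cc_bound f_sim).
have mK l : measurable (K l) by exact: compact_borel.
have K_sep l l' x y : l \in G -> l' \in G -> l != l' -> K l x -> K l' y ->
    delta * word_prod cc l <= enorm (x - y).
  move=> lG l'G ll' [x' Xx' <-] [y' Xy' <-].
  exact: (cut_separated f_maps cc_bound f_sim sep (ltW delta0) lG l'G ll').
(* Computing the masses of the cells requires one gap common to the whole finite cut. *)
have [e e0 eP] := @uniform_pos_lb R _ G (fun l => delta * word_prod cc l)
  (fun l _ => mulr_gt0 delta0 (word_prod_gt0 l cc_gt0)).
have K_sep' l l' x y : l \in G -> l' \in G -> l != l' -> K l x -> K l' y ->
    e <= enorm (x - y).
  by move=> lG *; apply: le_trans (eP _ lG) _; apply: K_sep; eassumption.
have muK := m_cell S_maps p_gt0 Xx0 X_compact p_sum mu_rss e0 K_compact K_sep'.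
have muU := m_cells S_maps p_gt0 Xx0 X_compact p_sum mu_rss h n
  (expR (- L)) e0 K_compact.
exists (size G); split=> //.
- have lnhmin : - (s * ln hmin) <= s * `|ln hmin|.
    by rewrite -mulrN ler_pM2l// -normrN ler_norm.
  have slnhmin : 0 <= s * `|ln hmin| by rewrite mulr_ge0// ltW.
  have hn' : eta * lam * n%:R <= eta * L + eta * lam.
    rewrite -mulrA -mulrDr ler_pM2l// (le_trans (ler_wpM2l (ltW lam0) nL))//.
    by rewrite mulrDr mulr1 mulrCA divff ?gt_eqF// mulr1.
  by rewrite ler_norml; apply/andP; split; lra.
- move=> m Gm; apply: le_trans (@quant_error_le _ _ _ _ _ _ _ _ r_gt0 mK muK m
    (fun l => word_map f l x0) (fun l => word_prod cc l * diam X) _ muU _) _.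
  + by rewrite G0.
  + move=> l _ lG [x Xx <-]; rewrite (word_map_sim f_maps f_sim)//.
    by rewrite ler_pM2l ?word_prod_gt0// enorm_le_diam.
  rewrite lee_fin -mulrA mulrCA -sumr_const_seq.
  rewrite big_seq [leRHS]big_seq; apply: ler_sum => l lG.
  have /andP[_ hl] := hG _ lG.
  rewrite powRM ?(ltW (word_prod_gt0 _ cc_gt0)) ?(ltW X_diam)//.
  rewrite mulrAC [leLHS]mulrC ler_pM2l ?powR_gt0//.
  by move: hl; rewrite word_prod_h mulrC.
- move=> m Gm.
  have := @quant_error_ge _ _ _ _ _ _ _ _ r_gt0 mK muK m
    (fun l => delta / 2 * word_prod cc l)
    ((delta / 2) `^ r * (hmin * expR (- L))).
  move=> /(_ (uniq_cut _ _ _ _)) H; apply: le_trans (H _ _ _ _).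
  + rewrite lee_fin.
    have : (size G)%:R <= 2 * (size G - m)%:R :> R.
      by rewrite -natrM ler_nat mulnBr mul2n -addnn -addnBA// leq_addr.
    have : 0 <= (delta / 2) `^ r * hmin * expR (- L).
      by rewrite !mulr_ge0 ?powR_ge0 ?expR_ge0// ltW.
    by move=> A0 le; have := ler_wpM2l A0 le; lra.
  + by move=> l; rewrite mulr_gt0 ?word_prod_gt0// divr_gt0.
  + move=> l l' x y lG l'G ll' Kx Ky; rewrite mulrA mulrCA divff// mulr1.
    exact: K_sep Kx Ky.
  + by rewrite !mulr_ge0 ?powR_ge0 ?expR_ge0// ltW.
  + move=> l lG; have /andP[hl _] := hG _ lG.
    rewrite [X in _ <= X * _]powRM ?(ltW (word_prod_gt0 _ cc_gt0))//;
      last by rewrite divr_ge0 ?(ltW delta0).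
    rewrite -mulrA.
    rewrite ler_pM2l ?powR_gt0 ?divr_gt0//.
    by move: hl; rewrite word_prod_h [leRHS]mulrC.
Qed.

End QuantizationBounds.

(** * From the bounds at each scale to the dimension *)

Section QuantizationDimension.
Context {R : realType} {d : nat}.

Lemma near_le_ln (k : R) : \forall n \near \oo, k <= ln n%:R :> R.
Proof.
exists (Num.trunc (expR k)).+1 => // n /= kn.
rewrite -(expRK k) ler_ln ?posrE ?expR_gt0 ?ltr0n ?(leq_trans _ kn)//.
by apply: le_trans (ltW (truncnS_gt _)) _; rewrite ler_nat.
Qed.

Variables (mu : probability (borelRd R d) R) (r s C1 C2 : R).
Hypothesis s01 : 0 < s < 1.
Hypothesis C10 : 0 < C1.
Hypothesis C20 : 0 < C2.
Hypothesis bounds : forall eta, 0 < eta ->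
  exists C, forall L, 0 <= L -> exists M : nat,
  [/\ (0 < M)%N, `|ln M%:R - s * L| <= C + eta * L,
    forall m, (M <= m)%N ->
      (quant_error r mu m <= (C1 * M%:R * expR (- L))%:E)%E &
    forall m, (2 * m <= M)%N ->
      ((C2 * M%:R * expR (- L))%:E <= quant_error r mu m)%E].

Let s0 : 0 < s. Proof. by case/andP: s01. Qed.

(** [L] solves [(s + eta) * L + C = ln n], which guarantees [M <= n]; the error is then at most
    [C1 * n * expR (- L)] with [L] close to [ln n / s]. *)
Lemma quant_error_near_le (delta : R) : 0 < delta -> \forall n \near \oo,
  (quant_error r mu n <= (expR (- ((s^-1 - 1 - delta) * ln n%:R)))%:E)%E.
Proof.
(* With this [eta], replacing [s^-1] by [(s + eta)^-1] costs at most [delta / 2]; the other half of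
   [delta] absorbs the constants for large [n]. *)
move=> delta0; pose eta := s ^+ 2 * delta / 2.
have eta0 : 0 < eta by rewrite !mulr_gt0 ?exprn_gt0// invr_gt0.
have [C CP] := bounds eta0.
have se0 : 0 < s + eta by rewrite addr_gt0.
have inv_ge : s^-1 - delta / 2 <= (s + eta)^-1.
  rewrite -(ler_pM2r se0) mulVf ?gt_eqF//.
  have -> : (s^-1 - delta / 2) * (s + eta) =
     1 - (s * delta / 2) * (s * delta / 2) by rewrite /eta; field; rewrite gt_eqF.
  by rewrite gerBl mulr_ge0// !mulr_ge0// ?ltW// invr_gt0.
have := near_le_ln (2 / delta * (ln C1 + `|C| / (s + eta))).
have := near_le_ln `|C|; have := near_le_ln 1.
apply: filterS3 => n n1 nC nk.
have n0 : 0 < n%:R :> R.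
  by rewrite ltr0n lt0n; apply/eqP => n0; move: n1; rewrite n0 ln0// ler10.
pose L := (ln n%:R - C) / (s + eta).
have L0 : 0 <= L.
  by rewrite divr_ge0 ?(ltW se0)// subr_ge0 (le_trans (ler_norm _) nC).
have [M [M0 hM le_M _]] := CP _ L0.
have MR0 : 0 < M%:R :> R by rewrite ltr0n.
have Le : L * (s + eta) = ln n%:R - C by rewrite /L divfK ?gt_eqF.
have lnMn : ln M%:R <= ln n%:R :> R.
  by move: hM; rewrite ler_norml => /andP[_]; lra.
have Mn : (M <= n)%N by move: lnMn; rewrite ler_ln// ler_nat.
apply: le_trans (le_M _ Mn) _; rewrite lee_fin.
rewrite -ler_ln ?posrE ?mulr_gt0 ?expR_gt0// !lnM ?posrE ?mulr_gt0 ?expR_gt0//.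
rewrite !expRK.
have LE : (s^-1 - delta / 2) * ln n%:R - `|C| / (s + eta) <= L.
  rewrite /L [leRHS]mulrBl; apply: lerB.
    by rewrite mulrC ler_wpM2l// (le_trans _ n1).
  by rewrite ler_wpM2r ?ler_norm// invr_ge0 ltW.
have : ln C1 + `|C| / (s + eta) <= delta / 2 * ln n%:R.
  rewrite -ler_pdivrMl ?divr_gt0// invf_div; exact: nk.
by move: lnMn LE; lra.
Qed.

(** Here [L] solves [(s - eta) * L - C = ln (2 * n)], which guarantees [2 * n <= M]. *)
Lemma quant_error_near_ge (delta : R) : 0 < delta -> \forall n \near \oo,
  ((expR (- ((s^-1 - 1 + delta) * ln n%:R)))%:E <= quant_error r mu n)%E.
Proof.
(* The bound [s / 2] keeps [s - eta] positive and controls the product term [s * delta / 2 * eta] in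
   [inv_le]. *)
move=> delta0; pose eta := Num.min (s / 2) (s ^+ 2 * delta / 4).
have eta0 : 0 < eta.
  by rewrite lt_min !mulr_gt0 ?exprn_gt0 ?invr_gt0.
have [C CP] := bounds eta0.
have eta1 : eta <= s / 2 by rewrite ge_min lexx.
have eta2 : eta <= s ^+ 2 * delta / 4 by rewrite ge_min lexx orbT.
have se0 : 0 < s - eta by have := s0; lra.
have inv_le : (s - eta)^-1 <= s^-1 + delta / 2.
  rewrite -(ler_pM2r se0) mulVf ?gt_eqF//.
  rewrite -(ler_pM2l s0) mulr1.
  have -> : s * ((s^-1 + delta / 2) * (s - eta)) =
      (1 + s * delta / 2) * (s - eta) by field; rewrite gt_eqF.
  have : s * delta / 2 * eta <= s * delta / 2 * (s / 2).
    by rewrite ler_wpM2l// !mulr_ge0 ?ltW// invr_gt0.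
  lra.
pose k := (s^-1 + delta / 2) * (ln 2 + `|C|) - ln C2 - ln 2.
have := near_le_ln (2 / delta * k); have := near_le_ln `|C|; have := near_le_ln 1.
apply: filterS3 => n n1 nC nk.
have n0 : 0 < n%:R :> R.
  by rewrite ltr0n lt0n; apply/eqP => n0; move: n1; rewrite n0 ln0// ler10.
have ln2 : 0 <= ln 2 :> R by rewrite ln_ge0// ler1n.
have nC' := lerNnormlW nC.
pose L := (ln 2 + ln n%:R + C) / (s - eta).
have L0 : 0 <= L.
  by rewrite divr_ge0 ?(ltW se0)//; lra.
have [M [M0 hM _ ge_M]] := CP _ L0.
have MR0 : 0 < M%:R :> R by rewrite ltr0n.
have Le : L * (s - eta) = ln 2 + ln n%:R + C by rewrite /L divfK ?gt_eqF.
have lnMn : ln 2 + ln n%:R <= ln M%:R :> R.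
  by move: hM; rewrite ler_norml => /andP[+ _]; lra.
have Mn : (2 * n <= M)%N.
  move: lnMn; rewrite -lnM ?posrE// -natrM ler_ln ?posrE ?natrM ?mulr_gt0//.
  by rewrite -natrM ler_nat.
apply: le_trans (ge_M _ Mn); rewrite lee_fin.
rewrite -ler_ln ?posrE ?mulr_gt0 ?expR_gt0// !lnM ?posrE ?mulr_gt0 ?expR_gt0//.
rewrite !expRK.
have LE : L <= (s^-1 + delta / 2) * (ln 2 + ln n%:R + `|C|).
  rewrite /L mulrC ler_pM//; first by rewrite invr_ge0 ltW.
    lra.
  by rewrite lerD2l ler_norm.
have : k <= delta / 2 * ln n%:R.
  rewrite -ler_pdivrMl ?divr_gt0// invf_div; exact: nk.
by rewrite /k; move: lnMn LE; lra.
Qed.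

(** The two estimates squeeze [- ln (v n) / ln n] to [s^-1 - 1], and the ratio is [r] divided by
    it. *)
Lemma quant_dim_of_bounds : has_quant_dim r mu (r / (s^-1 - 1))%:E.
Proof.
have rho0 : 0 < s^-1 - 1.
  by have /andP[_ s1] := s01; rewrite subr_gt0 invf_gt1.
suff cvg_ratio : quant_ratio r mu n @[n --> \oo] --> (r / (s^-1 - 1))%:E.
  rewrite /has_quant_dim /lower_quant_dim /upper_quant_dim.
  by rewrite !(cvg_limn_einf_sup cvg_ratio).
pose v n := fine (quant_error r mu n).
have vP (delta : R) : 0 < delta -> \forall n \near \oo,
    [/\ quant_error r mu n = (v n)%:E, 0 < v n, 0 < ln n%:R :> R &
    `|(s^-1 - 1) - (- ln (v n)) / ln n%:R| <= delta].
  move=> delta0; have := near_le_ln 1; have := quant_error_near_le delta0.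
  have := quant_error_near_ge delta0; apply: filterS3 => n le ge ln1.
  have lnn0 : 0 < ln n%:R :> R by exact: lt_le_trans ln1.
  have vE : quant_error r mu n = (v n)%:E.
    rewrite /v; move: le ge; case: (quant_error _ _ _) => //.
  rewrite vE !lee_fin in le ge.
  have v0 : 0 < v n by apply: lt_le_trans le; exact: expR_gt0.
  split=> //; move: le ge.
  rewrite -ler_ln ?posrE ?expR_gt0// expRK.
  rewrite -(ler_ln (v0 : v n \is Num.pos)) ?posrE ?expR_gt0// expRK => le ge.
  have h1 : - ln (v n) / ln n%:R <= s^-1 - 1 + delta.
    by rewrite ler_pdivrMr//; lra.
  have h2 : s^-1 - 1 - delta <= - ln (v n) / ln n%:R.
    by rewrite ler_pdivlMr//; lra.
  by rewrite ler_norml; apply/andP; split; lra.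
have cvg_v : (- ln (v n)) / ln n%:R @[n --> \oo] --> s^-1 - 1.
  by apply/cvgrPdist_le => e /vP; apply: filterS => n [].
have : r / ((- ln (v n)) / ln n%:R) @[n --> \oo] --> r / (s^-1 - 1).
  by apply: cvgM; [exact: cvg_cst|apply: cvgV => //; rewrite gt_eqF].
move=> cvg_r.
have cvg_E : (r / ((- ln (v n)) / ln n%:R))%:E @[n --> \oo] -->
    (r / (s^-1 - 1))%:E.
  by apply: cvg_EFin => //; exact: nearW.
apply: cvg_trans cvg_E; apply: near_eq_cvg.
(* A tolerance of half the limit keeps [ln (v n)] away from 0, so that the extended-real inverse
   agrees with the real one. *)
have := vP _ (divr_gt0 rho0 (ltr0Sn _ 1)); apply: filterS => n [vE v0 lnn0 h].
rewrite /quant_ratio vE lne_EFin// -EFinN inver; case: eqP => [v1|v1].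
  by exfalso; move: h; rewrite v1 mul0r subr0 ger0_norm ?(ltW rho0)//; lra.
by rewrite -EFinM invf_div mulrA.
Qed.

End QuantizationDimension.

(* The alphabet {1,...,N} of the random iterated function system is 'I_N.+1,
   i.e. the number of systems is N.+1 >= 1. *)
Theorem theorem2 (R : realType) (d N : nat) (X : set 'rV[R]_d)
    (I : 'I_N.+1 -> finType)
    (S : forall i : 'I_N.+1, I i -> 'rV[R]_d -> 'rV[R]_d)
    (c p : forall i : 'I_N.+1, I i -> R)
    (zeta : 'I_N.+1 -> R) (P : probability (Omega N) R) (r kappa : R)
    (d_gt0 : (0 < d)%N)
    (X_nonempty : X !=set0) (X_compact : compact X) (X_diam : 0 < diam X)
    (I_card : forall i, (1 < #|I i|)%N)
    (S_maps : forall i (j : I i) x, X x -> X (S i j x))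
    (S_sim : forall i (j : I i) x y, X x -> X y ->
      enorm (S i j x - S i j y) = c i j * enorm (x - y))
    (c_bound : forall i (j : I i), 0 < c i j < 1)
    (p_gt0 : forall i (j : I i), 0 < p i j)
    (p_sum : forall i, \sum_(j : I i) p i j = 1)
    (zeta_gt0 : forall i, 0 < zeta i)
    (zeta_sum : \sum_(i < N.+1) zeta i = 1)
    (P_bernoulli : is_bernoulli zeta P)
    (r_gt0 : 0 < r)
    (kappa_gt0 : 0 < kappa)
    (kappa_eq : \sum_(j < N.+1) zeta j *
      ln (\sum_(k : I j) (p j k * c j k `^ r) `^ (kappa / (r + kappa))) = 0)
    (S_uessc : uessc S X) :
  {ae P, forall w : Omega N, forall mu : probability (borelRd R d) R,
    is_rss_measure S p X w mu -> has_quant_dim r mu kappa%:E}.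
Proof.
pose s := kappa / (r + kappa).
have rk0 : 0 < r + kappa by rewrite addr_gt0.
have s0 : 0 < s by rewrite divr_gt0.
have s1 : s < 1 by rewrite ltr_pdivrMr// mul1r ltrDr.
have [C1 [C2 [C10 C20 bounds]]] := quant_error_bounds X_nonempty X_compact
  X_diam I_card S_maps S_sim c_bound p_gt0 p_sum r_gt0 s0 S_uessc.
(* [kappa_eq] says that the logarithms of the normalising sums have mean zero. The exceptional null
   set comes from here alone; the rest is deterministic for a fixed [w]. *)
have := ae_sublinear_sums (fun i => ltW (zeta_gt0 i)) zeta_sum P_bernoulli
  kappa_eq.
apply: filterS => w good mu mu_rss.
have kappaE : r / (s^-1 - 1) = kappa.
  have -> : s^-1 - 1 = r / kappa.
    by rewrite /s invf_div mulrDl divff ?gt_eqF// addrK.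
  by rewrite invf_div mulrCA divff ?mulr1// gt_eqF.
have s01 : 0 < s < 1 by rewrite s0 s1.
have := (quant_dim_of_bounds s01 C10 C20 (bounds _ good _ mu_rss)).
by rewrite kappaE.
Qed.
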